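(* Let $\Psi_0$ and $\Psi_2$ be root data, each with an action of $\mathrm{Gal}(k)$, let $(\phi,q^* )$ be a parascopic datum for $(\Psi_0,\Gamma,\Psi_2)$, where $\Gamma$ is a finite group, and let $1\to\Gamma_0\to\Gamma\to\Gamma_1\to 1$ be an exact sequence of groups. Then there exist a root datum $\Psi_1$ with an action of $\mathrm{Gal}(k)$ and, for $i=0,1$, parascopic data $(\phi_i,q_i^* )$ for $(\Psi_i,\Gamma_i,\Psi_{i+1})$, such that $(\phi,q^* )$ is a composition of $(\phi_0,q_0^* )$ and $(\phi_1,q_1^* )$. Moreover, if $(\phi,q^* )$ is torus-inclusive (resp. root-inclusive), then one can take $(\phi_0,q_0^* )$ and $(\phi_1,q_1^* )$ to be torus-inclusive (resp. root-inclusive) as well. In all cases, one can take $(\phi_0,q_0^* )$ to be torus-inclusive.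
   Context: Let $k$ be a field, $k^{\mathrm{sep}}$ a separable closure, $\mathrm{Gal}(k)=\mathrm{Gal}(k^{\mathrm{sep}}/k)$. Root data $\Psi=(X^*,\Phi,X_*,\Phi^\vee)$ need not be reduced, and $\mathrm{Gal}(k)$ acts on them continuously by automorphisms. A morphism from $\Psi$ to $\dot\Psi=(\dot X^*,\dot\Phi,\dot X_*,\dot\Phi^\vee)$ is a homomorphism $f^*\colon X^*\to\dot X^*$ with $f^*(\Phi)\subseteq\dot\Phi$ whose transpose $f_*\colon\dot X_*\to X_*$ satisfies $f_*(f^*(\alpha)^\vee)=\alpha^\vee$ for all $\alpha\in\Phi$. It is an embedding if $f^*$ is an isomorphism of lattices. $\Psi_{\mathrm{red}}$ is the root datum with the same lattices whose roots $\Phi_{\mathrm{red}}$ are the nondivisible roots of $\Phi$ if $\mathrm{char}\,k\ne2$, and the nonmultipliable roots of $\Phi$ if $\mathrm{char}\,k=2$, together with their coroots. Restricted root datum: let $\phi\colon\Gamma\to\mathrm{Aut}(\Psi)$ be an action of a finite group commuting with $\mathrm{Gal}(k)$ and preserving a system of positive roots. Then ${}_\phi\Psi=({}_\phi X^*,{}_\phi\Phi,{}_\phi X_*,{}_\phi\Phi^\vee)$ is the (possibly nonreduced) root datum with $\mathrm{Gal}(k)$-action in which ${}_\phi X^*$, ${}_\phi\Phi$ are the images of $X^*$, $\Phi$ in the coinvariants $(X^*\otimes\mathbb Q)_{\phi(\Gamma)}$, ${}_\phi X_*=X_*^{\phi(\Gamma)}$, and the coroot of $\bar\alpha\in{}_\phi\Phi$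 is $\sum_\theta\theta^\vee$ or its double (whichever pairs to $2$ with $\bar\alpha$; the double occurs only if the orbit is not orthogonal), the sum being over all $\theta\in\Phi$ mapping to $\bar\alpha$, which form a single $\Gamma$-orbit. A $\Gamma$-equivariant morphism $f^*$ of root data with such $\Gamma$-actions induces a morphism ${}_\Gamma f^*$ of restricted root data. Parascopic data: for root data $\Psi,\tilde\Psi$ with $\mathrm{Gal}(k)$-actions and a finite group $\Gamma$, a parascopic datum for $(\tilde\Psi,\Gamma,\Psi)$ is a pair $(\phi,q^* )$, where $\phi\colon\Gamma\to\mathrm{Aut}(\tilde\Psi)$ is a homomorphism whose image commutes with the action of $\mathrm{Gal}(k)$ and preserves some system of positive roots in $\tilde\Phi$, and $q^*$ is a $\mathrm{Gal}(k)$-equivariant morphism from $\Psi$ to ${}_\phi\tilde\Psi$. It is torus-inclusive if $q^*$ is an embedding, and root-inclusive if $q^*$ is a morphism from $\Psi$ to $({}_\phi\tilde\Psi)_{\mathrm{red}}$. Composition: given root data $\Psi_0,\Psi_1,\Psi_2$ with $\mathrm{Gal}(k)$-actions, finite groups $\Gamma,\Gamma_0,\Gamma_1$, parascopic data $(\phi_j,q_j^* )$ for $(\Psi_j,\Gamma_j,\Psi_{j+1})$ ($j=0,1$) and $(\phi,q^* )$ for $(\Psi_0,\Gamma,\Psi_2)$, we say that $(\phi,q^* )$ is a composition of $(\phi_0,q_0^* )$ and $(\phi_1,q_1^* )$ if: $\Gamma$ is an extension of $\Gamma_1$ by (the normal subgroup) $\Gamma_0$; $\phi_0=\phi|_{\Gamma_0}$;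 $q_0^*$ is $\Gamma_1$-equivariant with respect to the action $\phi_1$ on $\Psi_1$ and the action $\bar\phi$ of $\Gamma_1=\Gamma/\Gamma_0$ on ${}_{\phi_0}\Psi_0$ induced by $\phi$ (so it induces a morphism ${}_{\Gamma_1}q_0^*$ from ${}_{\phi_1}\Psi_1$ to ${}_{\bar\phi}({}_{\phi_0}\Psi_0)={}_\phi\Psi_0$); and $q^*={}_{\Gamma_1}q_0^*\circ q_1^*$. In the present proposition the extension is the given exact sequence. *)

(* Defs.v *)
From HB Require Import structures.
From mathcomp Require Import all_boot all_order all_algebra all_fingroup.
From mathcomp Require Import generic_quotient ring_quotient separable.
From mathcomp Require Import finmap boolp.

Set Implicit Arguments.
Unset Strict Implicit.
Unset Printing Implicit Defensive.

Import GRing.Theory Num.Theory.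
Local Open Scope ring_scope.
Local Open Scope quotient_scope.

(* [iota] embeds [k] in an algebraic, separable, separably closed [K]. *)
Definition separable_closure (k K : fieldType) (iota : {rmorphism k -> K}) :=
  (forall x : K, exists2 p : {poly k},
      separable_poly p & root (map_poly iota p) x)
  /\ (forall p : {poly K}, separable_poly p -> (1 < size p)%N ->
        exists x, root p x).

Section Galois.
Variables (k K : fieldType) (iota : {rmorphism k -> K}).

Record gal : Type := Gal {
  gal_fun :> K -> K;
  gal_inv : K -> K;
  galD : {morph gal_fun : x y / x + y};
  galM : {morph gal_fun : x y / x * y};
  gal_fix : forall c, gal_fun (iota c) = iota c;
  galK : cancel gal_fun gal_inv;
  galVK : cancel gal_inv gal_fun
}.

Lemma gal_ext (s t : gal) : s =1 t -> s = t.
Proof.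
case: s t => [f f' fD fM fF fK fVK] [g g' gD gM gF gK gVK] /= /funext efg.
have ef' : f' = g' by apply/funext => x; rewrite -{1}[x]gVK -efg fK.
by subst g g'; congr Gal; exact: Prop_irrelevance.
Qed.

Definition gal_one : gal.
Proof. by exists id id. Defined.

Definition gal_mul (s t : gal) : gal.
Proof.
exists (fun x => s (t x)) (fun x => gal_inv t (gal_inv s x)).
- by move=> x y; rewrite !galD.
- by move=> x y; rewrite !galM.
- by move=> c; rewrite !gal_fix.
- by move=> x; rewrite !galK.
- by move=> x; rewrite !galVK.
Defined.

Definition gal_opp (s : gal) : gal.
Proof.
exists (gal_inv s) s.
- by move=> x y; apply: (can_inj (galK s)); rewrite galD !galVK.
- by move=> x y; apply: (can_inj (galK s)); rewrite galM !galVK.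
- by move=> c; rewrite -{1}(gal_fix s c) galK.
- exact: galVK.
- exact: galK.
Defined.

Lemma gal_mulA : associative gal_mul.
Proof. by move=> s t u; apply: gal_ext. Qed.
Lemma gal_mul1 : left_id gal_one gal_mul.
Proof. by move=> s; apply: gal_ext. Qed.
Lemma gal_1mul : right_id gal_one gal_mul.
Proof. by move=> s; apply: gal_ext. Qed.
Lemma gal_mulV : left_inverse gal_one gal_opp gal_mul.
Proof. by move=> s; apply: gal_ext => x; exact: galK. Qed.
Lemma gal_mulVr : right_inverse gal_one gal_opp gal_mul.
Proof. by move=> s; apply: gal_ext => x; exact: galVK. Qed.

HB.instance Definition _ := gen_eqMixin gal.
HB.instance Definition _ := gen_choiceMixin gal.
HB.instance Definition _ :=
  isGroup.Build gal gal_mulA gal_mul1 gal_1mul gal_mulV gal_mulVr.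

End Galois.

(* The bare data (X^*, Phi, X_*, Phi^v), without the axioms of a root datum;
   [coroot] is only meaningful on [roots]. *)
Record quadruple := Quadruple {
  charlat : zmodType;
  cocharlat : zmodType;
  pairing : charlat -> cocharlat -> int;
  roots : {fset charlat};
  coroot : charlat -> cocharlat;
  pairingDl : forall y, {morph pairing^~ y : x x' / x + x'};
  pairingDr : forall x, {morph pairing x : y y' / y + y'}
}.

Definition is_lattice (V : zmodType) :=
  exists n (b : 'I_n -> V), bijective (fun c : 'rV[int]_n => \sum_i b i *~ c 0 i).

Definition perfect (V W : zmodType) (b : V -> W -> int) :=
  (forall f : V -> int, {morph f : x x' / x + x'} ->
     exists! y, forall x, f x = b x y)
  /\ (forall f : W -> int, {morph f : y y' / y + y'} ->
     exists! x, forall y, f y = b x y).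

(* No condition excludes roots a with a *+ 2 a root: D may be nonreduced. *)
Record is_root_datum (D : quadruple) : Prop := IsRootDatum {
  charlat_lattice : is_lattice (charlat D);
  cocharlat_lattice : is_lattice (cocharlat D);
  pairing_perfect : perfect (@pairing D);
  coroot_inj : {in roots D &, injective (@coroot D)};
  pairing_coroot : {in roots D, forall a, pairing a (coroot a) = 2};
  reflection_root : {in roots D &, forall a b,
    b - a *~ pairing b (coroot a) \in roots D};
  reflection_coroot : {in roots D &, forall a b,
    exists2 c, c \in roots D &
      coroot b - coroot a *~ pairing a (coroot b) = coroot c}
}.

Definition transpose (D E : quadruple) (f : charlat D -> charlat E)
    (g : cocharlat E -> cocharlat D) :=
  forall x y, pairing (f x) y = pairing x (g y).

Definition is_morphism (D E : quadruple) (f : charlat D -> charlat E) :=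
  [/\ {morph f : x y / x + y},
      {in roots D, forall a, f a \in roots E} &
      exists2 g, transpose f g &
        {in roots D, forall a, g (coroot (f a)) = coroot a}].

Definition is_embedding (D E : quadruple) (f : charlat D -> charlat E) :=
  is_morphism f /\ bijective f.

Definition is_automorphism (D : quadruple) (f : charlat D -> charlat D) :=
  is_morphism f /\
  exists g, [/\ is_morphism g, cancel f g & cancel g f].

(* A homomorphism [G -> Aut D], through the action on characters. *)
Definition is_action (G : groupType) (D : quadruple)
    (a : G -> charlat D -> charlat D) :=
  [/\ forall g, is_automorphism (a g),
      a 1%g =1 id &
      forall g h, a (g * h)%g =1 a g \o a h].

(* The roots positive on a regular cocharacter; rational or real regular
   functionals give the same sets. *)
Definition is_positive_system (D : quadruple) (P : {fset charlat D}) :=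
  exists y : cocharlat D,
    {in roots D, forall a, pairing a y != 0}
    /\ P = [fset a in roots D | 0 < pairing a y]%fset.

Definition preserves_positive_system (G : Type) (D : quadruple)
    (a : G -> charlat D -> charlat D) :=
  exists2 P : {fset charlat D}, is_positive_system P &
    forall g, {in P, forall x, a g x \in P}.

(* Nonmultipliable roots in characteristic 2, nondivisible ones otherwise. *)
Definition reduced_roots (k : fieldType) (D : quadruple) : {fset charlat D} :=
  if 2%N \in [pchar k] then [fset a in roots D | a *+ 2 \notin roots D]%fset
  else [fset a in roots D | all (fun b => b *+ 2 != a) (roots D)]%fset.

Definition red (k : fieldType) (D : quadruple) : quadruple :=
  Quadruple (reduced_roots k D) (@coroot D) (@pairingDl D) (@pairingDr D).

(* The construction makes sense for any family [a] of self-maps of X^*. *)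
Section Restriction.
Variables (D : quadruple) (G : Type) (a : G -> charlat D -> charlat D).

(* The kernel of X^* -> (X^* (x) Q)_G: the elements of X^* that are torsion
   modulo the subgroup generated by the a g x - x. *)
Definition coinv_ker : {pred charlat D} := fun x =>
  `[< exists n (s : seq (int * (G * charlat D))), (0 < n)%N /\
      x *+ n = \sum_(t <- s) (a t.2.1 t.2.2 - t.2.2) *~ t.1 >].

Lemma coinv_ker_zmod : zmod_closed coinv_ker.
Proof.
split; first by apply/asboolP; exists 1%N, [::]; rewrite big_nil mulr1n.
move=> x y /asboolP[n [s [n0 xs]]] /asboolP[m [r [m0 yr]]]; apply/asboolP.
exists (n * m)%N, ([seq (t.1 * m%:Z, t.2) | t <- s]
                   ++ [seq (- (t.1 * n%:Z), t.2) | t <- r]).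
split; first by rewrite muln_gt0 n0.
rewrite big_cat !big_map /= mulrnBl mulrnA xs mulnC mulrnA yr -!sumrMnl -sumrN.
congr (_ + _); apply: eq_bigr => t _; first by rewrite mulrzA pmulrn.
by rewrite mulrNz mulrzA pmulrn.
Qed.

HB.instance Definition _ :=
  GRing.isZmodClosed.Build (charlat D) coinv_ker coinv_ker_zmod.

Definition coinv : zmodType := Quotient.quot coinv_ker.

Definition coinv_proj (x : charlat D) : coinv := \pi_(Quotient.quot coinv_ker) x.
Definition coinv_repr (x : coinv) : charlat D :=
  repr (x : Quotient.quot coinv_ker).

(* The fixed vectors of X_* under the contragredient of [a]. *)
Definition inv_pred : {pred cocharlat D} := fun y =>
  `[< forall g x, pairing (a g x) y = pairing x y >].

Lemma pairing_linear_l (y : cocharlat D) : zmod_morphism ((@pairing D)^~ y).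
Proof.
have p0 : pairing (0 : charlat D) y = 0.
  by apply: (addrI (pairing 0 y)); rewrite -pairingDl !addr0.
move=> x x'; rewrite pairingDl; congr (_ + _); apply: (addIr (pairing x' y)).
by rewrite -pairingDl !addNr p0.
Qed.

Lemma pairing_linear_r (x : charlat D) : zmod_morphism (@pairing D x).
Proof.
have p0 : pairing x (0 : cocharlat D) = 0.
  by apply: (addrI (pairing x 0)); rewrite -pairingDr !addr0.
move=> y y'; rewrite pairingDr; congr (_ + _); apply: (addIr (pairing x y')).
by rewrite -pairingDr !addNr p0.
Qed.

Lemma inv_pred_zmod : zmod_closed inv_pred.
Proof.
have p0 x : pairing x (0 : cocharlat D) = 0.
  by rewrite -(subrr (0 : cocharlat D)) pairing_linear_r subrr.
split; first by apply/asboolP => g x; rewrite !p0.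
move=> y z /asboolP Hy /asboolP Hz; apply/asboolP => g x.
by rewrite !pairing_linear_r Hy Hz.
Qed.

HB.instance Definition _ :=
  GRing.isZmodClosed.Build (cocharlat D) inv_pred inv_pred_zmod.

Record invariants : Type :=
  Invariant { inv_val : cocharlat D; _ : inv_val \in inv_pred }.

HB.instance Definition _ := [isSub for inv_val].
HB.instance Definition _ := [Choice of invariants by <:].
HB.instance Definition _ := [SubChoice_isSubZmodule of invariants by <:].

Definition restr_pairing (x : coinv) (y : invariants) : int :=
  pairing (coinv_repr x) (val y).

Lemma restr_pairing_proj x y :
  restr_pairing (coinv_proj x) y = pairing x (val y).
Proof.
pose q := GRing.isZmodMorphism.Build _ _ _ (pairing_linear_l (val y)).
pose f : {additive charlat D -> int} :=
  HB.pack ((@pairing D)^~ (val y)) q.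
have : coinv_repr (coinv_proj x) - x \in coinv_ker.
  by rewrite Quotient.idealrBE /coinv_repr /coinv_proj reprK.
case/asboolP => n [s [n0 /(congr1 f)]]; rewrite raddfMn raddf_sum big1 => [|t _].
  move/eqP; rewrite mulrn_eq0 eqn0Ngt n0 raddfB subr_eq0 => /eqP.
  by [].
rewrite raddfMz raddfB /=; case: y @q @f => y Hy _ _ /=.
by move/asboolP: Hy => ->; rewrite subrr mul0rz.
Qed.

Lemma restr_pairingDl y : {morph restr_pairing^~ y : x x' / x + x'}.
Proof.
move=> x x'.
rewrite -[x](reprK (x : Quotient.quot coinv_ker)).
rewrite -[x'](reprK (x' : Quotient.quot coinv_ker)).
rewrite -[_ + _](raddfD (\pi_(Quotient.quot coinv_ker))).
by rewrite !restr_pairing_proj pairingDl.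
Qed.

Lemma restr_pairingDr x : {morph restr_pairing x : y y' / y + y'}.
Proof. by move=> y y'; rewrite /restr_pairing raddfD pairingDr. Qed.

Definition fibre_sum (x : coinv) : cocharlat D :=
  \sum_(t <- roots D | coinv_proj t == x) coroot t.

(* The coroot is the fibre sum or its double, whichever pairs to 2. The default
   value of [insubd] is not used when [a] is an action by automorphisms, see
   [restr_corootE]. *)
Definition restr_coroot (x : coinv) : invariants :=
  insubd (0 : invariants)
    (if pairing (coinv_repr x) (fibre_sum x) == 2 then fibre_sum x
     else fibre_sum x *+ 2).

Definition restr : quadruple :=
  Quadruple [fset coinv_proj t | t in roots D]%fset restr_coroot
    restr_pairingDl restr_pairingDr.

End Restriction.

Lemma restr_corootE (G : groupType) (D : quadruple)
    (a : G -> charlat D -> charlat D) (x : coinv a) : is_action a ->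
  val (restr_coroot x) =
    if pairing (coinv_repr x) (fibre_sum x) == 2 then fibre_sum x
    else fibre_sum x *+ 2.
Proof.
case=> aut a1 aM; rewrite /restr_coroot val_insubd ifT //.
suff Sinv : fibre_sum x \in inv_pred a by case: ifP => // _; rewrite rpredMn.
apply/asboolP => g y; rewrite /fibre_sum.
have [[_ root_g [gt gtP gtc]] _] := aut g.
have aK h z : a h^-1%g (a h z) = z.
  by rewrite -[LHS](aM h^-1%g h) mulVg a1.
have perm_g : perm_eq [seq a g t | t <- roots D] (roots D).
  apply: uniq_perm; rewrite ?fset_uniq ?map_inj_uniq ?fset_uniq //.
    exact: can_inj (aK g).
  move=> t; apply/mapP/idP => [[u uD ->]|tD]; first exact: root_g.
  exists (a g^-1%g t); last by rewrite -[RHS](aM g) mulgV a1.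
  by have [[_ r _] _] := aut g^-1%g; apply: r.
pose f z : {additive cocharlat D -> int} :=
  HB.pack (pairing z) (GRing.isZmodMorphism.Build _ _ _ (pairing_linear_r z)).
rewrite -[LHS]/(f _ _) -[RHS]/(f _ _) !raddf_sum /=.
rewrite -(perm_big _ perm_g) big_map big_seq_cond [RHS]big_seq_cond.
apply: eq_big => [t|t /andP[tD _]]; last by rewrite gtP gtc.
congr (_ && (_ == _)); apply/eqP; rewrite -Quotient.idealrBE.
apply/asboolP; exists 1%N, [:: (1, (g, t))]; split=> //.
by rewrite big_seq1.
Qed.

(* Independent of the representative when [f] maps the kernel for [a] into the
   kernel for [b], e.g. when [f] is additive and equivariant. *)
Definition restr_map (D E : quadruple) (G H : Type)
    (a : G -> charlat D -> charlat D) (b : H -> charlat E -> charlat E)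
    (f : charlat D -> charlat E) : charlat (restr a) -> charlat (restr b) :=
  fun x => coinv_proj b (f (coinv_repr x)).
Arguments restr_map {D E G H} a b f x.

Section Parascopy.
Variables (k K : fieldType) (iota : {rmorphism k -> K}).

(* Continuity, for the Krull topology: the stabiliser of each character contains
   the pointwise fixator of a finite subset of [K]. *)
Record galois_root_datum := GaloisRootDatum {
  grd :> quadruple;
  grd_root_datum : is_root_datum grd;
  grd_act : gal iota -> charlat grd -> charlat grd;
  grd_actP : is_action grd_act;
  grd_act_continuous : forall x, exists s : seq K, forall t : gal iota,
    {in s, forall c, t c = c} -> grd_act t x = x
}.

(* Parascopic data for (E, G, D): the larger datum E comes first. *)
Record parascopic_datum (E : galois_root_datum) (G : finGroupType)
    (D : galois_root_datum) := ParascopicDatum {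
  ps_act : G -> charlat E -> charlat E;
  ps_map : charlat D -> charlat (restr ps_act);
  ps_actP : is_action ps_act;
  ps_commute : forall g t x,
    ps_act g (grd_act t x) = grd_act t (ps_act g x);
  ps_positive : preserves_positive_system ps_act;
  ps_morphism : is_morphism ps_map;
  ps_equivariant : forall t x,
    ps_map (grd_act t x) = restr_map ps_act ps_act (grd_act t) (ps_map x)
}.

Definition torus_inclusive E G D (P : parascopic_datum E G D) :=
  is_embedding (ps_map P).

Definition root_inclusive E G D (P : parascopic_datum E G D) :=
  @is_morphism D (red k (restr (ps_act P))) (ps_map P).

Definition short_exact (G0 G G1 : finGroupType)
    (i : {morphism [set: G0] >-> G}) (p : {morphism [set: G] >-> G1}) :=
  [/\ ('injm i)%g, ('ker p = i @* [set: G0])%g & (p @* [set: G] = [set: G1])%g].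

Section Composition.
Variables (G0 G G1 : finGroupType).
Variables (i : {morphism [set: G0] >-> G}) (p : {morphism [set: G] >-> G1}).
Variables (D0 D1 D2 : galois_root_datum).
Variables (P : parascopic_datum D0 G D2).
Variables (P0 : parascopic_datum D0 G0 D1) (P1 : parascopic_datum D1 G1 D2).

Definition lift_along (g1 : G1) : G := odflt 1%g [pick g | p g == g1].

(* The action of G1 = G / G0 on the restriction of D0 along G0; under the
   hypotheses of [is_composition] it does not depend on the chosen lifts. *)
Definition quotient_act (g1 : G1) :
    charlat (restr (ps_act P0)) -> charlat (restr (ps_act P0)) :=
  restr_map (ps_act P0) (ps_act P0) (ps_act P (lift_along g1)).

(* The canonical identification of the iterated restriction with the
   restriction along G, induced by the identity of X^*. *)
Definition restr_restr (x : charlat (restr quotient_act)) :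
    charlat (restr (ps_act P)) :=
  coinv_proj (ps_act P) (coinv_repr (coinv_repr x)).

Definition is_composition :=
  [/\ forall g0, ps_act P0 g0 =1 ps_act P (i g0),
      forall g1 x, ps_map P0 (ps_act P1 g1 x) = quotient_act g1 (ps_map P0 x) &
      ps_map P =1
        restr_restr \o restr_map (ps_act P1) quotient_act (ps_map P0)
                    \o ps_map P1].

End Composition.
End Parascopy.

(* Main.v *)
(* Take Psi_1 to be the restriction of Psi_0 along Gamma_0, or its reduced root
   datum in the root-inclusive case, with q_0 the identity; q_1 is then q. The
   substance is that a restriction is a root datum and that restricting along
   Gamma_0 and then along Gamma_1 gives the restriction along Gamma.

   A preserved positive system yields a Gamma-invariant cocharacter rho that
   vanishes on no root, so no root dies in the coinvariants. Hence two roots of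
   a fibre of X^* -> X^*_Gamma never differ by a root, so distinct ones are at
   an obtuse angle; together with the positivity of
   Q(y, y') = \sum_b <b, y> <b, y'> this forces a root to pair to 1 or 2 with
   the sum of the coroots of its fibre.

   All identities between restricted coroots (reflections, equivariance,
   transitivity) follow from one principle: a restricted coroot of x is the only
   invariant y in the rational span of the coroots with <x, y> = 2 and
   Q(y, -) proportional to <x, -> on invariants. *)
From HB Require Import structures.
From mathcomp Require Import all_boot all_order all_algebra all_fingroup.
From mathcomp Require Import generic_quotient ring_quotient finmap boolp.
From mathcomp Require Import zify ring.
Require Import Defs.

Set Implicit Arguments.
Unset Strict Implicit.
Unset Printing Implicit Defensive.

Import Order.TTheory GRing.Theory Num.Theory.
Local Open Scope ring_scope.
Local Open Scope quotient_scope.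

(** * Lattices, dual families and kernels of functionals *)

Section Lattices.
Variable V : zmodType.

(** The functionals [u i] read off coordinates. Indices range over a subset [A] because bases of
    invariants arise below as part of a larger basis. *)
Lemma is_lattice_of_dual (T : finType) (A : {pred T}) (v : T -> V)
    (u : T -> V -> int) :
  (forall i, {morph u i : x y / x + y}) ->
  {in A &, forall i j, u i (v j) = (i == j)%:R} ->
  (forall x, x = \sum_(i in A) v i *~ u i x) -> is_lattice V.
Proof.
move=> uD uv def_x; exists #|A|, (fun i => v (enum_val i)).
exists (fun x => \row_i u (enum_val i) x) => [c|x]; last first.
  rewrite [RHS]def_x [RHS]big_enum_val; apply: eq_bigr => i _; by rewrite mxE.
apply/rowP => j; rewrite mxE.
have uB : zmod_morphism (u (enum_val j)).
  move=> x y; apply: (addIr (u (enum_val j) y)).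
  by rewrite -uD !subrK.
pose f : {additive V -> int} :=
  HB.pack (u (enum_val j)) (GRing.isZmodMorphism.Build _ _ _ uB).
rewrite -[LHS]/(f _) raddf_sum; under eq_bigr => i _ do
  rewrite raddfMz /= uv ?enum_valP // (inj_eq enum_val_inj).
rewrite (bigD1 j) //= eqxx intz big1 ?addr0 // => i ij.
by rewrite eq_sym (negPf ij) mul0rz.
Qed.

Lemma lattice_mulrn_eq0 (x : V) n :
  is_lattice V -> x *+ n = 0 -> (n == 0%N) || (x == 0).
Proof.
case=> m [b [h hK Kh]]; case: n => [|n] //= xn0; apply/eqP.
pose F (c : 'rV[int]_m) := \sum_i b i *~ c 0 i.
have FM (c : 'rV[int]_m) k : F (c *+ k) = F c *+ k.
  by rewrite /F -sumrMnl; apply: eq_bigr => i _;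
    rewrite mulmxnE -mulr_natr natz mulrzA pmulrn.
have F0 : F 0 = 0 by rewrite -(mulr0n 0) FM.
suff: h x = 0 by rewrite -{2}[x]Kh => ->.
have : h x *+ n.+1 = 0.
  by apply: (can_inj hK); rewrite -/(F _) -/(F 0) FM F0 /F Kh.
move/matrixP => H; apply/matrixP => i j; move: (H i j).
by rewrite mulmxnE !mxE => /eqP; rewrite mulrn_eq0 => /eqP.
Qed.

(* A Smith normal form of the matrix of the functionals [phi] makes their common
   kernel a direct summand spanned by part of a basis. *)
Lemma common_kernel_summand (K : finType) (phi : K -> {additive V -> int}) :
  is_lattice V ->
  exists n (J : {pred 'I_n}) (v : 'I_n -> V) (u : 'I_n -> {additive V -> int}),
  [/\ {in J, forall j k, phi k (v j) = 0},
      {in J &, forall i j, u i (v j) = (i == j)%:R} &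
      forall y, (forall k, phi k y = 0) -> y = \sum_(j in J) v j *~ u j y].
Proof.
case=> n [b [h hK Kh]].
pose F (c : 'rV[int]_n) := \sum_i b i *~ c 0 i.
have FB : zmod_morphism F.
  move=> c c'; rewrite /F -sumrB; apply: eq_bigr => i _.
  by rewrite !mxE mulrzBr.
have hB : zmod_morphism h.
  by move=> x y; apply: (can_inj hK); rewrite -!/(F _) FB /F !Kh.
pose A := \matrix_(i < n, j < #|K|) phi (enum_val j) (b i).
have phiF (c : 'rV[int]_n) (j : 'I_#|K|) : phi (enum_val j) (F c) = (c *m A) 0 j.
  rewrite /F raddf_sum mxE; apply: eq_bigr => i _.
  by rewrite raddfMz mxE /= -mulrzr intz mulrC.
have [L Lu [R Ru [d _ defA]]] := int_Smith_normal_form A.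
set M := (X in L *m X *m R) in defA.
(* Indices of the zero rows of [M]: the diagonal entry vanishes, or the index lies beyond the last
   column. *)
pose J : {pred 'I_n} := fun i => (i < #|K|)%N ==> (d`_i == 0).
have MJ (c : 'rV[int]_n) : c *m M = 0 -> forall i, i \notin J -> c 0 i = 0.
  move=> cM0 i; rewrite /J unfold_in negb_imply => /andP[iK di].
  have /matrixP/(_ 0 (Ordinal iK)) := cM0.
  rewrite !mxE (bigD1 i) //= mxE eqxx big1 => [|l li].
    by rewrite addr0 mulr1n => /eqP; rewrite mulf_eq0 (negPf di) orbF => /eqP.
  by rewrite mxE /= (negPf (li : l != i :> nat)) mulr0n mulr0.
(* The rows of [invmx L] form the adapted basis, with coordinate functionals [u0]. *)
pose v i := F ((delta_mx 0 i : 'rV[int]_n) *m invmx L).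
pose u0 i y := (h y *m L) 0 i.
have uB i : zmod_morphism (u0 i).
  by move=> x y; rewrite /u0 hB mulmxBl !mxE.
pose u i : {additive V -> int} :=
  HB.pack (u0 i) (GRing.isZmodMorphism.Build _ _ _ (uB i)).
exists n, J, v, u; split.
- move=> j jJ k; rewrite /v -(enum_rankK k) phiF defA !mulmxA mulmxKV //.
  suff -> : (delta_mx 0 j : 'rV[int]_n) *m M = 0 by rewrite mul0mx mxE.
  apply/rowP => l; rewrite mxE (bigD1 j) //= big1 => [|i ij]; rewrite !mxE; last first.
    by rewrite eqxx (negPf ij) mul0r.
  have [jl|_] := eqVneq (j : nat) l; last by rewrite mulr0n mulr0 addr0.
  by move: jJ; rewrite unfold_in jl ltn_ord /= => /eqP->; rewrite mul0rn mulr0 addr0.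
- move=> i j _ _; rewrite /= /u0 /v /F hK mulmxKV // mxE eqxx /=.
  by rewrite eq_sym.
- move=> y phiy; have cJ : forall i, i \notin J -> (h y *m L) 0 i = 0.
    apply: MJ; apply: (can_inj (mulmxK Ru)); rewrite mul0mx -!mulmxA.
    rewrite [L *m _]mulmxA -defA; apply/rowP => l.
    by rewrite -phiF /F Kh phiy mxE.
  have FK c : F c = \sum_i F (delta_mx 0 i) *~ c 0 i.
    apply: eq_bigr => i _; congr (_ *~ _); rewrite /F (bigD1 i) //= !mxE !eqxx.
    by rewrite mulr1z big1 ?addr0 // => j ji; rewrite mxE (negPf ji) andbF.
  have Fsum (I : finType) (P : pred I) (f : I -> 'rV[int]_n) :
      F (\sum_(i | P i) f i) = \sum_(i | P i) F (f i).
    pose F' : {additive 'rV[int]_n -> V} :=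
      HB.pack F (GRing.isZmodMorphism.Build _ _ _ FB).
    by rewrite -[LHS]/(F' _) raddf_sum.
  have FMz c (m : int) : F (c *~ m) = F c *~ m.
    pose F' : {additive 'rV[int]_n -> V} :=
      HB.pack F (GRing.isZmodMorphism.Build _ _ _ FB).
    by rewrite -[LHS]/(F' _) raddfMz.
  rewrite -[LHS]Kh -/(F _) -[h y in LHS](mulmxK Lu) {1}[h y *m L]row_sum_delta.
  rewrite mulmx_suml Fsum (bigID (mem J)) /= [X in _ + X]big1 => [|i /cJ ->].
    rewrite addr0; apply: eq_bigr => i _.
    by rewrite -scalemxAl -FMz -scaler_int intz.
  by rewrite scale0r mul0mx /F big1 // => l _; rewrite mxE mulr0z.
Qed.

End Lattices.

(** * Bilinearity of the pairing *)

Section Pairing.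
Variable D : quadruple.
Implicit Types (x : charlat D) (y : cocharlat D).

HB.instance Definition _ x :=
  GRing.isZmodMorphism.Build _ _ (pairing x) (pairing_linear_r x).

Definition pairing_left y x := pairing x y.
HB.instance Definition _ y :=
  GRing.isZmodMorphism.Build _ _ (pairing_left y) (pairing_linear_l y).

Lemma pairing0l y : pairing 0 y = 0.
Proof. exact: (raddf0 (pairing_left y)). Qed.

Lemma pairingBl x x' y : pairing (x - x') y = pairing x y - pairing x' y.
Proof. exact: (raddfB (pairing_left y)). Qed.

Lemma pairingNl x y : pairing (- x) y = - pairing x y.
Proof. exact: (raddfN (pairing_left y)). Qed.

Lemma pairing_suml I (r : seq I) (P : pred I) (f : I -> charlat D) y :
  pairing (\sum_(i <- r | P i) f i) y = \sum_(i <- r | P i) pairing (f i) y.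
Proof. exact: (raddf_sum (pairing_left y)). Qed.

Lemma pairingMzl x (m : int) y : pairing (x *~ m) y = m * pairing x y.
Proof.
by rewrite -[LHS]/(pairing_left y _) raddfMz -mulrzr intz mulrC.
Qed.

Lemma pairingMzr x (m : int) y : pairing x (y *~ m) = m * pairing x y.
Proof. by rewrite raddfMz -mulrzr intz mulrC. Qed.

End Pairing.

(* Reindexing the sum by the reflection turns [S = \sum b *~ B b t'] into
   [t *~ (\sum (B b t') ^+ 2) - S]. *)
Lemma sum_reflection (V : zmodType) (B : {additive V -> int}) (L : seq V) t :
  uniq L -> B t = 2 -> {in L, forall b, b - t *~ B b \in L} ->
  (\sum_(b <- L) b *~ B b) *+ 2 = t *~ \sum_(b <- L) B b ^+ 2.
Proof.
move=> uL Bt refl; pose s b := b - t *~ B b.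
have Bs b : B (s b) = - B b.
  rewrite /s raddfB raddfMz Bt -mulrzr intz; ring.
have sK : involutive s.
  by move=> b; rewrite {1}/s Bs mulrNz opprK /s subrK.
have us : uniq (map s L) by rewrite map_inj_uniq //; apply: inv_inj.
have sL : {subset map s L <= L} by move=> b /mapP[c cL ->]; apply: refl.
have /uniq_perm/(_ uL) perm_s := us.
have {}/perm_s perm_s : map s L =i L.
  by case: (uniq_min_size us sL); rewrite ?size_map.
rewrite mulr2n -{1}(perm_big _ perm_s) big_map /= -big_split /=.
rewrite mulrz_sumr; apply: eq_bigr => b _.
rewrite Bs mulrNz /s mulrzBl opprB subrK -mulrzA; congr (_ *~ _); ring.
Qed.

(** * The form Q, the span of the coroots, and differences of roots *)

Section RootDatum.
Variables (D : quadruple) (rD : is_root_datum D).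
Implicit Types (x t : charlat D) (y : cocharlat D).

Lemma charlat_mulrz_eq0 x (m : int) : m != 0 -> x *~ m = 0 -> x = 0.
Proof.
have H n : x *+ n.+1 = 0 -> x = 0.
  by move/(lattice_mulrn_eq0 (charlat_lattice rD)) => /= /eqP.
case: m => [[|n]|n] // _; first exact: H.
by rewrite NegzE mulrNz => /eqP; rewrite oppr_eq0 => /eqP/H.
Qed.

Lemma cocharlat_mulrz_eq0 y (m : int) : m != 0 -> y *~ m = 0 -> y = 0.
Proof.
have H n : y *+ n.+1 = 0 -> y = 0.
  by move/(lattice_mulrn_eq0 (cocharlat_lattice rD)) => /= /eqP.
case: m => [[|n]|n] // _; first exact: H.
by rewrite NegzE mulrNz => /eqP; rewrite oppr_eq0 => /eqP/H.
Qed.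

Lemma pairing_ndl x : (forall y, pairing x y = 0) -> x = 0.
Proof.
move=> x0; have [_ /(_ (fun=> 0))] := pairing_perfect rD.
case=> [|z [_ uz]]; first by move=> *; rewrite addr0.
by rewrite -(uz x) // -(uz 0) // => y; rewrite pairing0l.
Qed.

Lemma pairing_ndr y : (forall x, pairing x y = 0) -> y = 0.
Proof.
move=> y0; have [/(_ (fun=> 0)) + _] := pairing_perfect rD.
case=> [|z [_ uz]]; first by move=> *; rewrite addr0.
by rewrite -(uz y) // -(uz 0) // => x; rewrite raddf0.
Qed.

Lemma root_opp t : t \in roots D -> - t \in roots D.
Proof.
move=> tD; have := reflection_root rD tD tD.
by rewrite (pairing_coroot rD tD) -pmulrn mulr2n opprD addrA subrr sub0r.
Qed.

(** The form Q: positive semidefinite, its radical being the cocharacters killed by all roots. *)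
Definition coform y y' := \sum_(b <- roots D) pairing b y * pairing b y'.

Lemma coform_is_zmod_morphism y : zmod_morphism (coform y).
Proof.
move=> u v; rewrite /coform -sumrB; apply: eq_bigr => b _.
by rewrite raddfB mulrBr.
Qed.
HB.instance Definition _ y :=
  GRing.isZmodMorphism.Build _ _ (coform y) (coform_is_zmod_morphism y).

Lemma coformC y y' : coform y y' = coform y' y.
Proof. by apply: eq_bigr => b _; rewrite mulrC. Qed.

Lemma coformBl y y' u : coform (y - y') u = coform y u - coform y' u.
Proof. by rewrite coformC raddfB /= !(coformC u). Qed.

Lemma coformDl y y' u : coform (y + y') u = coform y u + coform y' u.
Proof. by rewrite coformC raddfD /= !(coformC u). Qed.

Lemma coformMzr y (m : int) u : coform y (u *~ m) = m * coform y u.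
Proof. by rewrite raddfMz -mulrzr intz mulrC. Qed.

Lemma coformMzl y (m : int) u : coform (y *~ m) u = m * coform y u.
Proof. by rewrite coformC coformMzr coformC. Qed.

Lemma coform_ge0 y : 0 <= coform y y.
Proof. by apply: sumr_ge0 => b _; rewrite -expr2 sqr_ge0. Qed.

Lemma coform_eq0 y : coform y y = 0 -> {in roots D, forall b, pairing b y = 0}.
Proof.
move/eqP; rewrite psumr_eq0 => [/allP H b /H|b _]; last by rewrite -expr2 sqr_ge0.
by rewrite mulf_eq0 orbb => /eqP.
Qed.

Lemma coform_coroot_gt0 t : t \in roots D -> 0 < coform (coroot t) (coroot t).
Proof.
move=> tD; rewrite lt0r coform_ge0 andbT; apply/eqP => /coform_eq0/(_ t tD).
by rewrite (pairing_coroot rD tD).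
Qed.

Lemma sum_root_coroot t : t \in roots D ->
  (\sum_(b <- roots D) b *~ pairing b (coroot t)) *+ 2
    = t *~ coform (coroot t) (coroot t).
Proof.
move=> tD; apply: (sum_reflection (B := pairing_left (coroot t))).
- exact: fset_uniq.
- exact: pairing_coroot.
- by move=> b bD; apply: reflection_root.
Qed.

(** [sum_root_coroot] paired with [y]. Hence [Q(t^v, -)] is a rational multiple of [<t, ->], which
    is how roots and coroots determine each other below. *)
Lemma coform_coroot t y : t \in roots D ->
  coform (coroot t) (coroot t) * pairing t y = 2 * coform (coroot t) y.
Proof.
move=> /sum_root_coroot/(congr1 (pairing_left y)).
rewrite raddfMn raddf_sum raddfMz /= /pairing_left -mulrzr intz mulrC => <-.
rewrite -[LHS]mulr_natl; congr (_ * _); apply: eq_bigr => b _.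
by rewrite pairingMzl.
Qed.

(** The coroots are stable under reflections as well, so [sum_reflection] applies on the dual side;
    this places coroots in [coroot_span]. *)
Lemma sum_coroot t : t \in roots D ->
  (\sum_(b <- roots D) coroot b *~ pairing t (coroot b)) *+ 2
    = coroot t *~ \sum_(b <- roots D) pairing t (coroot b) ^+ 2.
Proof.
move=> tD; have := @sum_reflection _ (pairing t) (map (@coroot D) (roots D)) (coroot t).
rewrite !big_map; apply.
- by rewrite map_inj_in_uniq ?fset_uniq //; apply: coroot_inj.
- exact: pairing_coroot.
- move=> _ /mapP[b bD ->]; have [c cD ->] := reflection_coroot rD tD bD.
  exact: map_f.
Qed.

(* Membership in the rational span of the coroots, witnessed by a preimage [u]
   under the map [u |-> \sum_b coroot b *~ pairing u (coroot b)]. *)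
Definition coroot_span y :=
  exists (m : int) (u : charlat D),
  [/\ m != 0,
      forall z, {in roots D, forall b, pairing b z = 0} -> pairing u z = 0 &
      y *~ m = \sum_(b <- roots D) coroot b *~ pairing u (coroot b)].

Lemma coroot_span_coroot t : t \in roots D -> coroot_span (coroot t).
Proof.
(* Both witnesses are read off [sum_coroot]; the sum of squares is nonzero because its term at [t]
   is 4. *)
move=> tD; exists (\sum_(b <- roots D) pairing t (coroot b) ^+ 2), (t *+ 2); split.
- rewrite psumr_eq0 => [|b _]; last exact: sqr_ge0.
  by apply/allPn; exists t => //=; rewrite (pairing_coroot rD tD).
- by move=> z z0; rewrite pmulrn pairingMzl z0 ?mulr0.
- rewrite -sum_coroot // -sumrMnl; apply: eq_bigr => b _.
  by rewrite !pmulrn pairingMzl -mulrzA mulrC.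
Qed.

Lemma coroot_span0 : coroot_span 0.
Proof.
exists 1, 0; split=> // [z _|]; first exact: pairing0l.
by rewrite big1 ?mul0rz // => b _; rewrite pairing0l.
Qed.

Lemma coroot_spanD y y' : coroot_span y -> coroot_span y' -> coroot_span (y + y').
Proof.
case=> [m [u [m0 uz yE]]] [m' [u' [m'0 u'z y'E]]].
exists (m * m'), (u *~ m' + u' *~ m); split; first by rewrite mulf_neq0.
  by move=> z z0; rewrite pairingDl !pairingMzl uz ?u'z // !mulr0.
rewrite mulrzDl mulrzA yE (mulrC m) mulrzA y'E !mulrz_suml -big_split.
apply: eq_bigr => b _ /=.
by rewrite pairingDl !pairingMzl mulrzDr !(mulrC m, mulrC m') !mulrzA.
Qed.

Lemma coroot_spanMz y (m : int) : coroot_span y -> coroot_span (y *~ m).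
Proof.
case=> [e [u [e0 uz yE]]]; exists e, (u *~ m); split=> //.
  by move=> z z0; rewrite pairingMzl uz ?mulr0.
rewrite -mulrzA mulrC mulrzA yE mulrz_suml; apply: eq_bigr => b _.
by rewrite pairingMzl mulrC mulrzA.
Qed.

(** If Q(y, y) = 0, every root kills [y], hence so does the witness [u]. But [m <u, y>] is the sum
    of the squares of the [<u, b^v>], so these all vanish. Thus Q is definite on the span of the
    coroots. *)
Lemma coroot_span_eq0 y : coroot_span y -> coform y y = 0 -> y = 0.
Proof.
case=> [m [u [m0 uz yE]]] /coform_eq0 y0; apply: (cocharlat_mulrz_eq0 m0).
rewrite yE big_seq big1 // => b bD.
suff -> : pairing u (coroot b) = 0 by rewrite mulr0z.
have /eqP := congr1 (pairing u) yE; rewrite pairingMzr uz // mulr0 eq_sym raddf_sum.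
rewrite psumr_eq0 => [/allP/(_ b bD)|c _]; rewrite /= pairingMzr -expr2;
  last exact: sqr_ge0.
by rewrite sqrf_eq0 => /eqP.
Qed.

(** If one of the two mutual pairings is 1, a reflection gives the difference up to sign. Otherwise
    both are at least 2, which makes Q vanish on the difference of the coroots and forces
    [t = t']. *)
Lemma root_sub t t' : t \in roots D -> t' \in roots D -> t != t' ->
  0 < pairing t (coroot t') -> t - t' \in roots D.
Proof.
move=> tD t'D tt' gt0.
set a := pairing t (coroot t') in gt0; set b := pairing t' (coroot t).
have Qa := coform_coroot (coroot t') tD; have Qb := coform_coroot (coroot t) t'D.
have qt := coform_coroot_gt0 tD; have qt' := coform_coroot_gt0 t'D.
rewrite -/a in Qa; rewrite -/b coformC in Qb.
set q := coform (coroot t) (coroot t) in Qa qt *.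
set q' := coform (coroot t') (coroot t') in Qb qt' *.
set c := coform (coroot t) (coroot t') in Qa Qb.
have b0 : 0 < b.
  by rewrite -(pmulr_rgt0 _ qt') Qb -Qa pmulr_rgt0.
have [a1|a1] := eqVneq a 1.
  by have := reflection_root rD t'D tD; rewrite -/a a1.
have [b1|b1] := eqVneq b 1.
  by have /root_opp := reflection_root rD tD t'D; rewrite -/b b1 opprB.
have a2 : 2 <= a by lia.
have b2 : 2 <= b by lia.
have d0 := coform_ge0 (coroot t - coroot t').
have dE : coform (coroot t - coroot t') (coroot t - coroot t') = q + q' - 2 * c.
  rewrite raddfB /= !coformBl -/q -/q' -/c (coformC (coroot t')) -/c; ring.
have qc : q <= c by nia.
have qc' : q' <= c by nia.
have d00 : coform (coroot t - coroot t') (coroot t - coroot t') = 0 by lia.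
have {}d00 := coform_eq0 d00.
have qq : q = q' by lia.
suff : t - t' = 0 by move/eqP; rewrite subr_eq0 (negPf tt').
(* Since [q = q'], both [q t] and [q' t'] are given by [sum_root_coroot], and their difference only
   involves pairings with the difference of the coroots. *)
apply: (@charlat_mulrz_eq0 _ q); first by rewrite gt_eqF.
rewrite mulrzBl {2}qq -!sum_root_coroot // -mulrnBl -sumrB big_seq big1 ?mul0rn //.
by move=> r rD'; rewrite -mulrzBr -[X in _ *~ X](raddfB (pairing r)) /= d00 ?mulr0z.
Qed.

(** The product of the reflections in [L], applied to [x]: by orthogonality each reflection leaves
    the coefficients of the others unchanged. *)
Lemma root_sub_orthogonal (L : seq (charlat D)) x :
  {subset L <= roots D} -> uniq L ->
  {in L &, forall t t', t != t' -> pairing t (coroot t') = 0} ->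
  x \in roots D -> x - \sum_(t <- L) t *~ pairing x (coroot t) \in roots D.
Proof.
elim: L => [|t L IH] sub; first by rewrite big_nil subr0.
case/andP=> tL uL orth xD; rewrite big_cons opprD addrCA addrC.
have H : x - \sum_(u <- L) u *~ pairing x (coroot u) \in roots D.
  apply: IH => // [u uL'|u v uL' vL']; first by apply: sub; rewrite inE uL' orbT.
  by apply: orth; rewrite inE ?uL' ?vL' orbT.
have tD : t \in roots D by apply: sub; rewrite mem_head.
have := reflection_root rD tD H.
suff -> : pairing (x - \sum_(u <- L) u *~ pairing x (coroot u)) (coroot t)
  = pairing x (coroot t) by [].
rewrite pairingBl pairing_suml big_seq big1 ?subr0 // => u uL'.
rewrite pairingMzl (orth u t) ?mulr0 ?mem_head ?inE ?uL' ?orbT //.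
by apply: contraNneq tL => <-.
Qed.

End RootDatum.

(** * Coinvariants of characters and invariants of cocharacters *)

Section Coinvariants.
Variables (D : quadruple) (G : Type) (a : G -> charlat D -> charlat D).
Implicit Types (x : charlat D) (y : cocharlat D).

Lemma pairing_inv g x y : y \in inv_pred a -> pairing (a g x) y = pairing x y.
Proof. by move/asboolP. Qed.

Lemma coinv_projK z : coinv_proj a (coinv_repr z) = z.
Proof. exact: (reprK (z : Quotient.quot (coinv_ker a))). Qed.

Lemma coinv_proj_is_zmod_morphism : zmod_morphism (coinv_proj a).
Proof. exact: (raddfB (\pi_(Quotient.quot (coinv_ker a)))). Qed.
HB.instance Definition _ :=
  GRing.isZmodMorphism.Build _ _ (coinv_proj a) coinv_proj_is_zmod_morphism.

Lemma coinv_proj_pairing x x' y : y \in inv_pred a ->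
  coinv_proj a x = coinv_proj a x' -> pairing x y = pairing x' y.
Proof.
by move=> yI xx'; rewrite -!(restr_pairing_proj _ (Invariant yI)) xx'.
Qed.

Lemma pairing_repr_proj x y : y \in inv_pred a ->
  pairing (coinv_repr (coinv_proj a x)) y = pairing x y.
Proof. by move/coinv_proj_pairing; apply; rewrite coinv_projK. Qed.

Lemma val_invariant (y : invariants a) : val y \in inv_pred a.
Proof. exact: valP. Qed.

End Coinvariants.

(** * Duality between coinvariants and invariants of a finite group *)

Section Action.
Variables (D : quadruple) (rD : is_root_datum D) (G : finGroupType).
Variables (a : G -> charlat D -> charlat D) (aP : is_action a).
Implicit Types (x t : charlat D) (y : cocharlat D).

Lemma actB g : zmod_morphism (a g).
Proof.
have [/(_ g)[[aD _ _] _] _ _] := aP.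
by move=> x y; apply: (addIr (a g y)); rewrite -aD !subrK.
Qed.
HB.instance Definition _ g := GRing.isZmodMorphism.Build _ _ (a g) (actB g).

Lemma act1 x : a 1%g x = x.
Proof. by have [_ ->] := aP. Qed.

Lemma actM g h x : a (g * h)%g x = a g (a h x).
Proof. by have [_ _ ->] := aP. Qed.

Lemma act_root g t : t \in roots D -> a g t \in roots D.
Proof. by have [/(_ g)[[_ + _] _] _ _] := aP; apply. Qed.

(** This is the sum of the translates of [y]. As the action is given on characters only, perfectness
    produces it from the functional it represents. *)
Lemma inv_average y :
  exists2 y', y' \in inv_pred a & forall x, pairing x y' = \sum_g pairing (a g x) y.
Proof.
have [/(_ (fun x => \sum_g pairing (a g x) y))+ _] := pairing_perfect rD.
case=> [x x'|y' [def_y' _]].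
  by rewrite -big_split; apply: eq_bigr => g _; rewrite raddfD pairingDl.
exists y' => //; apply/asboolP => h x; rewrite -!def_y' [RHS](reindex_inj (mulIg h)).
by apply: eq_bigr => g _; rewrite actM.
Qed.

(** By averaging, the translates of [x - x'] sum to a character killed by every cocharacter, hence
    to 0. So [#|G|] times [x - x'] is a combination of elements [a g z - z]. This is the converse of
    [coinv_proj_pairing]. *)
Lemma eq_coinv_proj x x' :
  (forall y, y \in inv_pred a -> pairing x y = pairing x' y) ->
  coinv_proj a x = coinv_proj a x'.
Proof.
move=> xx'; apply/eqP; rewrite -Quotient.idealrBE; apply/asboolP.
have N0 : \sum_g a g (x - x') = 0.
  apply: (pairing_ndl rD) => y; have [y' /xx' y'I y'E] := inv_average y.
  by rewrite pairing_suml -y'E pairingBl y'I subrr.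
exists #|G|, [seq (-1, (g, x - x')) | g <- enum G]; split.
  by apply/card_gt0P; exists 1%g.
have -> : (x - x') *+ #|G| = \sum_(g : G) (x - x') by rewrite sumr_const.
transitivity (\sum_(g : G) (x - x') - \sum_g a g (x - x')); first by rewrite N0 subr0.
rewrite big_map big_enum -sumrB; apply: eq_big => // g _.
by rewrite mulrNz mulr1z opprB.
Qed.

Lemma coinv_proj_act g x : coinv_proj a (a g x) = coinv_proj a x.
Proof. by apply: eq_coinv_proj => y yI; apply: pairing_inv. Qed.

(** Invariance may be tested on a basis of characters, so finitely many functionals cut out the
    invariants and [common_kernel_summand] applies. *)
Lemma inv_summand :
  exists n (J : {pred 'I_n}) (v : 'I_n -> cocharlat D)
         (u : 'I_n -> {additive cocharlat D -> int}),
  [/\ {in J, forall j, v j \in inv_pred a},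
      {in J &, forall i j, u i (v j) = (i == j)%:R} &
      forall y, y \in inv_pred a -> y = \sum_(j in J) v j *~ u j y].
Proof.
have [m [e [c _ Ke]]] := charlat_lattice rD.
pose phi (k : G * 'I_m) : {additive cocharlat D -> int} :=
  pairing (a k.1 (e k.2) - e k.2).
have [n [J [v [u [vI uv def_y]]]]] := common_kernel_summand phi (cocharlat_lattice rD).
exists n, J, v, u; split=> // [j jJ|y yI]; last first.
  by apply: def_y => k; rewrite /phi /= pairingBl pairing_inv // subrr.
apply/asboolP => g x; apply/eqP; rewrite -subr_eq0 -pairingBl -[x]Ke.
rewrite raddf_sum -sumrB pairing_suml big1 // => i _.
by rewrite raddfMz -mulrzBl pairingMzl -[pairing _ _]/(phi (g, i) (v j)) vI ?mulr0.
Qed.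

Lemma invariants_lattice : is_lattice (invariants a).
Proof.
have [n [J [v [u [vI uv def_y]]]]] := inv_summand.
have vE j : j \in J -> val (insubd (0 : invariants a) (v j)) = v j.
  by move=> jJ; rewrite insubdK // vI.
apply: (@is_lattice_of_dual _ _ J (fun j => insubd (0 : invariants a) (v j))
         (fun j (y : invariants a) => u j (val y))).
- by move=> j y y'; rewrite !raddfD.
- by move=> i j iJ jJ; rewrite /= vE // uv.
- move=> y; apply: val_inj; rewrite {1}[val y]def_y ?val_invariant //.
  by rewrite raddf_sum; apply: eq_bigr => j jJ; rewrite raddfMz /= vE.
Qed.

(** A functional on coinvariants is represented upstairs by a cocharacter that is then invariant; a
    functional on invariants extends to all cocharacters because the invariants are a direct
    summand. *)
Lemma restr_pairing_perfect : perfect (@pairing (restr a)).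
Proof.
split=> f fD.
  have [/(_ (fun x => f (coinv_proj a x)))+ _] := pairing_perfect rD.
  case=> [x x'|y [def_y uniq_y]]; first by rewrite raddfD fD.
  have yI : y \in inv_pred a.
    by apply/asboolP => g x; rewrite -!def_y coinv_proj_act.
  exists (Invariant yI); split=> [x|y' y'E].
    by rewrite -{1}[x]coinv_projK def_y.
  apply: val_inj; apply: uniq_y => x; rewrite y'E.
  exact: restr_pairing_proj.
have [n [J [v [u [vI uv def_y]]]]] := inv_summand.
have fB : zmod_morphism f.
  by move=> x y; apply: (addIr (f y)); rewrite -fD !subrK.
pose F : {additive invariants a -> int} :=
  HB.pack f (GRing.isZmodMorphism.Build _ _ _ fB).
(* The extension by zero on the complement; the default value 0 of [insubd] never occurs for [j] in
   [J]. *)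
have [_ /(_ (fun y => \sum_(j in J) f (insubd 0 (v j)) * u j y))+]
  := pairing_perfect rD.
case=> [y y'|x [def_x _]].
  by rewrite -big_split; apply: eq_bigr => j _; rewrite raddfD mulrDr.
exists (coinv_proj a x); split=> [y|z zE].
  rewrite [RHS]restr_pairing_proj -def_x.
  rewrite -[f y]/(F y); suff {1}-> : y = \sum_(j in J) insubd 0 (v j) *~ u j (val y).
    by rewrite raddf_sum; apply: eq_bigr => j _; rewrite raddfMz /= -mulrzr intz.
  apply: val_inj; rewrite {1}[val y]def_y ?val_invariant // raddf_sum.
  by apply: eq_bigr => j jJ; rewrite raddfMz /= insubdK // vI.
rewrite -[z]coinv_projK; apply: eq_coinv_proj => y yI; rewrite -def_x.
rewrite -[RHS](zE (Invariant yI)) -[f _]/(F _).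
suff -> : Invariant yI = \sum_(j in J) insubd 0 (v j) *~ u j y.
  by rewrite raddf_sum; apply: eq_bigr => j _; rewrite raddfMz /= -mulrzr intz.
apply: val_inj; rewrite [LHS]/= {1}[y]def_y // raddf_sum.
by apply: eq_bigr => j jJ; rewrite raddfMz /= insubdK // vI.
Qed.

(** The classes of the characters representing the [u j] form the basis dual to [v]. *)
Lemma coinv_lattice : is_lattice (coinv a).
Proof.
have [n [J [v [u [vI uv def_y]]]]] := inv_summand.
have /choice[w wE] i : exists x, forall y, u i y = pairing x y.
  have [_ /(_ (u i))[|x [xE _]]] := pairing_perfect rD; first exact: raddfD.
  by exists x.
have iE j : j \in J -> val (insubd (0 : invariants a) (v j)) = v j.
  by move=> jJ; rewrite insubdK // vI.
apply: (@is_lattice_of_dual _ _ J (fun j => coinv_proj a (w j))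
         (fun j (z : coinv a) => restr_pairing z (insubd 0 (v j)))).
- by move=> j; apply: restr_pairingDl.
- by move=> i j iJ jJ /=; rewrite restr_pairing_proj iE // -wE uv // eq_sym.
- move=> z; rewrite -{1}[z]coinv_projK; under eq_bigr => j _ do rewrite -raddfMz.
  rewrite -raddf_sum; apply: eq_coinv_proj => y yI.
  rewrite pairing_suml {1}[y]def_y // raddf_sum; apply: eq_bigr => j jJ.
  by rewrite pairingMzl -wE raddfMz /= -mulrzr intz mulrC /restr_pairing iE // mulrC.
Qed.

End Action.

(** Only the root set changes, so that taking all roots or [reduced_roots] treats the full and the
    reduced intermediate datum at once. *)
Definition subdatum (E : quadruple) (R : {fset charlat E}) : quadruple :=
  Quadruple R (@coroot E) (@pairingDl E) (@pairingDr E).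

(** * The uniqueness principle for restricted coroots *)

Section CorootDirection.
Variables (D : quadruple) (rD : is_root_datum D) (G : Type).
Variables (a : G -> charlat D -> charlat D).
Implicit Types (x t : charlat D) (y : cocharlat D).

(* Up to scaling, [y] is the combination of coroots dual to the class of [x];
   such a [y] is determined by its pairing with [x], see [coroot_dir_uniq]. *)
Definition coroot_dir x y := coroot_span y /\
  exists l : int, forall y', y' \in inv_pred a -> 2 * coform y y' = l * pairing x y'.

Lemma coroot_dir0 x : coroot_dir x 0.
Proof.
split; first exact: coroot_span0.
by exists 0 => y' _; rewrite coformC raddf0 mulr0 mul0r.
Qed.

Lemma coroot_dirD x y y' : coroot_dir x y -> coroot_dir x y' -> coroot_dir x (y + y').
Proof.
case=> [sy [l yE]] [sy' [l' y'E]]; split; first exact: coroot_spanD.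
by exists (l + l') => u uI; rewrite coformDl mulrDr yE // y'E // mulrDl.
Qed.

Lemma coroot_dirMz x y (m : int) : coroot_dir x y -> coroot_dir x (y *~ m).
Proof.
case=> [sy [l yE]]; split; first exact: coroot_spanMz.
by exists (m * l) => u uI; rewrite coformMzl mulrCA yE // mulrA.
Qed.

Lemma coroot_dir_sum x I (r : seq I) (P : pred I) (f : I -> cocharlat D) :
  (forall i, P i -> coroot_dir x (f i)) -> coroot_dir x (\sum_(i <- r | P i) f i).
Proof.
by move=> H; apply: big_ind => //; [exact: coroot_dir0 | exact: coroot_dirD].
Qed.

Lemma coroot_dir_coroot x t : t \in roots D ->
  coinv_proj a t = coinv_proj a x -> coroot_dir x (coroot t).
Proof.
move=> tD tx; split; first exact: coroot_span_coroot.
exists (coform (coroot t) (coroot t)) => y yI.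
by rewrite -(coinv_proj_pairing yI tx) coform_coroot.
Qed.

(** The difference [d] pairs to 0 with [x], so it is Q-orthogonal to [y] and to [y']. Then Q(d, d) =
    0, and Q is definite on the span of the coroots. *)
Lemma coroot_dir_uniq x y y' :
  y \in inv_pred a -> y' \in inv_pred a -> coroot_dir x y -> coroot_dir x y' ->
  pairing x y = pairing x y' -> y = y'.
Proof.
move=> yI y'I [sy [l yE]] [sy' [l' y'E]] xy.
apply/eqP; rewrite -subr_eq0; apply/eqP; apply: (coroot_span_eq0 rD).
  by have := coroot_spanD sy (coroot_spanMz (-1) sy'); rewrite mulrN1z.
have dI : y - y' \in inv_pred a by apply: rpredB.
have := yE _ dI; have := y'E _ dI; rewrite coformBl !(raddfB (pairing x)) /= xy; lia.
Qed.

End CorootDirection.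

(** * Fibres of the restriction map and the restricted root datum *)

Section RestrictedRoots.
Variables (D : quadruple) (rD : is_root_datum D) (G : finGroupType).
Variables (a : G -> charlat D -> charlat D) (aP : is_action a).
Variables (rho : cocharlat D) (rhoI : rho \in inv_pred a).
Hypothesis rho_reg : {in roots D, forall b, pairing b rho != 0}.
Implicit Types (x t : charlat D) (y : cocharlat D).

Local Notation pr := (coinv_proj a).
Local Notation F t := (val (restr_coroot (pr t))).
Local Notation fibre t := [seq u <- roots D | pr u == pr t].

Lemma restr_rootP (z : coinv a) :
  reflect (exists2 t, t \in roots D & z = pr t) (z \in roots (restr a)).
Proof. exact: imfsetP. Qed.

Lemma fibre_obtuse t t' : t \in roots D -> t' \in roots D -> pr t = pr t' ->
  t != t' -> pairing t (coroot t') <= 0.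
Proof.
move=> tD t'D tt' neq; rewrite leNgt; apply/negP => /(root_sub rD tD t'D neq).
by move/rho_reg; rewrite pairingBl (coinv_proj_pairing rhoI tt') subrr.
Qed.

Lemma fibre_sum_inv (z : coinv a) : fibre_sum z \in inv_pred a.
Proof.
(* [restr_coroot] is invariant by its type, and halving preserves this if the sum was doubled. *)
have := val_invariant (restr_coroot z); rewrite (restr_corootE z aP).
case: ifP => // _ /asboolP H; apply/asboolP => g x.
by have := H g x; rewrite !raddfMn /=; lia.
Qed.

Lemma fibre_sum_dir x : coroot_dir a x (fibre_sum (pr x)).
Proof.
rewrite /fibre_sum big_seq_cond; apply: coroot_dir_sum => t /andP[tD /eqP].
exact: coroot_dir_coroot.
Qed.

Lemma pairing_fibre_sumE t : t \in roots D ->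
  pairing t (fibre_sum (pr t)) =
    2 + \sum_(u <- fibre t | u != t) pairing t (coroot u).
Proof.
move=> tD; rewrite /fibre_sum raddf_sum -big_filter (bigD1_seq t) /=.
- by rewrite pairing_coroot.
- by rewrite mem_filter eqxx tD.
- by rewrite filter_uniq ?fset_uniq.
Qed.

Lemma fibre_obtuse_cond t : t \in roots D ->
  forall u, u \in fibre t -> u != t -> pairing t (coroot u) <= 0.
Proof.
move=> tD u; rewrite mem_filter => /andP[/eqP ut uD] neq.
by apply: fibre_obtuse => //; rewrite eq_sym.
Qed.

(** Summing [coform_coroot] over the fibre gives [A <t, N> = 2 Q(N, N)] with [A] positive. If
    [<t, N> <= 0], then all roots kill [N], and summing [sum_root_coroot] over the fibre gives a
    positive combination of the fibre equal to 0. Pairing it with [rho] yields [A <t, rho> = 0],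
    against regularity. *)
Lemma pairing_fibre_sum_gt0 t : t \in roots D -> 0 < pairing t (fibre_sum (pr t)).
Proof.
move=> tD; set N := fibre_sum _; rewrite ltNge; apply/negP => le0.
have NI : N \in inv_pred a := fibre_sum_inv _.
pose q u := coform (@coroot D u) (coroot u).
have [inD inpr] : {subset fibre t <= roots D} /\ {in fibre t, forall u, pr u = pr t}.
  by split=> u; rewrite mem_filter => /andP[/eqP].
pose A := \sum_(u <- fibre t) q u.
have A0 : 0 < A.
  rewrite /A (bigD1_seq t) ?filter_uniq ?fset_uniq ?mem_filter ?eqxx //=.
  by rewrite ltr_pwDl ?coform_coroot_gt0 // sumr_ge0 // => u _; apply: coform_ge0.
have QN : A * pairing t N = 2 * coform N N.
  transitivity (\sum_(u <- fibre t) 2 * coform N (coroot u)); last first.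
    by rewrite -mulr_sumr -raddf_sum big_filter.
  rewrite /A mulr_suml; apply: eq_big_seq => u uL.
  by rewrite -(coinv_proj_pairing NI (inpr u uL)) coform_coroot ?inD // coformC.
have /coform_eq0 N0 : coform N N = 0.
  by have := coform_ge0 N; nia.
have : \sum_(u <- fibre t) u *~ q u = 0.
  transitivity ((\sum_(b <- roots D) b *~ pairing b N) *+ 2); last first.
    by rewrite big_seq big1 ?mul0rn // => b /N0 ->.
  rewrite -sumrMnl; under [RHS]eq_bigr => b _ do
    rewrite /N /fibre_sum raddf_sum mulrz_sumr -sumrMnl.
  rewrite [RHS]exchange_big -[RHS]big_filter [LHS]big_seq [RHS]big_seq.
  by apply: eq_bigr => u /inD uD; rewrite sumrMnl sum_root_coroot.
move/(congr1 (pairing_left rho)); rewrite raddf_sum raddf0 /=.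
under eq_big_seq => u uL do
  rewrite /pairing_left pairingMzl (coinv_proj_pairing rhoI (inpr u uL)).
by rewrite -mulr_suml => /eqP; rewrite mulf_eq0 gt_eqF //= (negPf (rho_reg tD)).
Qed.

Lemma pairing_fibre_sum t : t \in roots D ->
  pairing t (fibre_sum (pr t)) = 1 \/ pairing t (fibre_sum (pr t)) = 2.
Proof.
move=> tD; have := pairing_fibre_sum_gt0 tD; rewrite pairing_fibre_sumE //.
have : \sum_(u <- fibre t | u != t) pairing t (coroot u) <= 0.
  rewrite big_seq_cond; apply: sumr_le0 => u /andP[uL neq].
  exact: fibre_obtuse_cond.
by move: (\sum_(_ <- _ | _) _) => s; lia.
Qed.

(** The terms of the fibre other than [t] are nonpositive and sum to 0. *)
Lemma fibre_orthogonal t u : t \in roots D -> u \in roots D -> pr u = pr t ->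
  u != t -> pairing t (fibre_sum (pr t)) = 2 -> pairing t (coroot u) = 0.
Proof.
move=> tD uD ut neq; rewrite pairing_fibre_sumE // -[RHS]addr0 => /addrI/eqP.
rewrite -oppr_eq0 -sumrN big_seq_cond psumr_eq0 => [/allP/(_ u)|v /andP[vL vt]].
  rewrite mem_filter ut eqxx uD neq /= => /(_ isT).
  by rewrite oppr_eq0 => /eqP.
by rewrite oppr_ge0 fibre_obtuse_cond.
Qed.

(** The terms other than [t] are nonpositive and sum to -1, so some [u] of the fibre has
    [<t, u^v> = -1], and the reflection of [t] in [u] is [t + u]. *)
Lemma fibre_nonorthogonal t : t \in roots D -> pairing t (fibre_sum (pr t)) = 1 ->
  exists2 u, u \in roots D & pr u = pr t *+ 2.
Proof.
move=> tD; rewrite pairing_fibre_sumE // => sE.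
have [/hasP[u uL /andP[neq lt0]]|/hasPn none] :=
    boolP (has (fun u => (u != t) && (pairing t (coroot u) < 0)) (fibre t)); last first.
  move: sE; rewrite big_seq_cond big1 ?addr0 // => u /andP[uL neq].
  apply/eqP; rewrite eq_le fibre_obtuse_cond // leNgt.
  by have := none u uL; rewrite neq.
have := uL; rewrite mem_filter => /andP[/eqP ut uD].
have uE : pairing t (coroot u) = -1.
  move: sE; rewrite -big_filter (bigD1_seq u) /= ?filter_uniq ?fset_uniq //; last first.
    by rewrite mem_filter neq.
  suff : \sum_(v <- [seq v <- fibre t | v != t] | v != u) pairing t (coroot v) <= 0.
    by move: (\sum_(_ <- _ | _) _) lt0 => s; lia.
  rewrite big_seq_cond; apply: sumr_le0 => v /andP[].
  rewrite mem_filter => /andP[vt vL] _.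
  exact: fibre_obtuse_cond.
exists (t + u); last by rewrite raddfD /= ut.
by have := reflection_root rD uD tD; rewrite uE mulrN1z opprK.
Qed.

Lemma restr_coroot_dir x : coroot_dir a x (F x).
Proof.
rewrite (restr_corootE _ aP); case: ifP => _; first exact: fibre_sum_dir.
by rewrite pmulrn; apply: coroot_dirMz; apply: fibre_sum_dir.
Qed.

Lemma pairing_restr_coroot t : t \in roots D -> pairing t (F t) = 2.
Proof.
move=> tD; rewrite (restr_corootE _ aP) pairing_repr_proj ?fibre_sum_inv //.
by have [E|E] := pairing_fibre_sum tD; rewrite E //= pmulrn pairingMzr E.
Qed.

Lemma restr_coroot_uniq t y : t \in roots D -> y \in inv_pred a ->
  coroot_dir a t y -> pairing t y = 2 -> F t = y.
Proof.
move=> tD yI ydir y2; apply: (coroot_dir_uniq rD (x := t)) (restr_coroot_dir t) _ _ => //.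
  exact: val_invariant.
by rewrite pairing_restr_coroot.
Qed.

(* If the fibre of the class of [t] is orthogonal, the reflection is induced by the
   product of the reflections in the fibre. Otherwise twice that class is again a
   restricted root, with the same reflection. *)
Lemma restr_reflection t b : t \in roots D -> b \in roots D ->
  exists2 c, c \in roots D & pr c = pr b - pr t *~ pairing b (F t).
Proof.
(* Passing to a root over twice the class of [t] doubles [|<t, rho>|], which is nonzero and at most
   [M]; the induction is on a bound for the remaining gap. *)
move=> tD bD; move: tD; pose M := \sum_(u <- roots D) `|pairing u rho|.
have lebound u : u \in roots D -> `|pairing u rho| <= M.
  by move=> uD; rewrite /M (bigD1_seq u) ?fset_uniq //= ler_wpDr // sumr_ge0.
have [n] : exists n : nat, M < `|pairing t rho| + n%:Z.
  by exists `|M|.+1; lia.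
elim: n t => [|n IH] t ltn tD; first by have := lebound t tD; lia.
have [E|E] := pairing_fibre_sum tD.
  have [u uD uE] := fibre_nonorthogonal tD E.
  have ut y : y \in inv_pred a -> pairing u y = 2 * pairing t y.
    move=> yI; have /(coinv_proj_pairing yI) -> : pr u = pr (t *+ 2) by rewrite raddfMn.
    by rewrite pmulrn pairingMzl.
  have [|//|c cD cE] := IH u.
    by rewrite ut // normrM; have := rho_reg tD; lia.
  exists c => //; rewrite cE; congr (_ - _).
  (* Doubling the class halves the coroot, so the two reflections agree. *)
  have -> : F t = F u *~ 2.
    apply: restr_coroot_uniq => //.
    - by rewrite -pmulrn rpredMn // val_invariant.
    - have [sp [l lE]] := coroot_dirMz 2 (restr_coroot_dir u).
      split=> //; exists (l * 2) => y yI; rewrite lE // ut //; ring.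
    - have := ut _ (val_invariant (restr_coroot (pr u))).
      rewrite pairing_restr_coroot // pairingMzr => H; rewrite -H //.
  by rewrite pairingMzr {1}uE pmulrn -mulrzA.
have inL u : u \in fibre t = (pr u == pr t) && (u \in roots D) by rewrite mem_filter.
exists (b - \sum_(u <- fibre t) u *~ pairing b (coroot u)).
  apply: root_sub_orthogonal => // [u||]; rewrite ?filter_uniq ?fset_uniq //.
    by rewrite inL => /andP[].
  move=> u v; rewrite !inL => /andP[/eqP ut uD] /andP[/eqP vt vD] neq.
  apply: fibre_orthogonal; rewrite // 1?eq_sym ?ut //.
  by rewrite (coinv_proj_pairing (fibre_sum_inv _) ut).
rewrite raddfB raddf_sum /=; congr (_ - _).
rewrite (restr_corootE _ aP) pairing_repr_proj ?fibre_sum_inv // E eqxx.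
rewrite /fibre_sum -[X in pairing b X]big_filter (raddf_sum (pairing b)) mulrz_sumr.
by apply: eq_big_seq => u; rewrite inL raddfMz /= => /andP[/eqP ->].
Qed.

Lemma restr_reflection_coroot t b c : t \in roots D -> b \in roots D -> c \in roots D ->
  pr c = pr b - pr t *~ pairing b (F t) ->
  F c = F b - F t *~ pairing t (F b).
Proof.
move=> tD bD cD cE.
have [sb [lb bE]] := restr_coroot_dir b; have [st [lt tE]] := restr_coroot_dir t.
have Fi u : F u \in inv_pred a := val_invariant _.
have cP y : y \in inv_pred a ->
    pairing c y = pairing b y - pairing b (F t) * pairing t y.
  move=> yI; rewrite -pairingMzl -pairingBl; apply: (coinv_proj_pairing yI).
  by rewrite raddfB raddfMz.
(* Symmetry of Q lets the constant [lb] of [b] serve for the reflected coroot, as the uniqueness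
   principle requires. *)
have symm : lt * pairing t (F b) = lb * pairing b (F t).
  by rewrite -tE // -bE // coformC.
have dI : F b - F t *~ pairing t (F b) \in inv_pred a.
  by rewrite rpredB ?rpredMz.
apply: restr_coroot_uniq => //.
- split; first by rewrite -mulrNz; apply: coroot_spanD => //; apply: coroot_spanMz.
  exists lb => y yI; rewrite coformBl coformMzl cP // !mulrBr bE //.
  by rewrite mulrCA tE // mulrA (mulrC _ lt) symm -mulrA.
- rewrite cP // !raddfB /= !pairingMzr !pairing_restr_coroot //; ring.
Qed.

Lemma subdatum_restr_root_datum (R : {fset charlat (restr a)}) :
  {subset R <= roots (restr a)} ->
  {in R &, forall z w, w - z *~ pairing w (coroot z) \in R} ->
  is_root_datum (subdatum R).
Proof.
move=> sR reflR; split.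
- exact: coinv_lattice.
- exact: invariants_lattice.
- exact: restr_pairing_perfect.
- move=> z w /sR/restr_rootP[t tD ->] /sR/restr_rootP[u uD ->] E.
  (* Both classes pair to 2 with the common coroot, so they have the same proportionality constant.
     It is nonzero, hence the classes agree on all invariants. *)
  have {}E : F t = F u by rewrite [restr_coroot _]E.
  have [_ [l lE]] := restr_coroot_dir t; have [_ [m mE]] := restr_coroot_dir u.
  have Fi v : F v \in inv_pred a := val_invariant _.
  have lm : l = m.
    have := lE _ (Fi t); have := mE _ (Fi u).
    by rewrite !pairing_restr_coroot // E => ->; lia.
  have l0 : l != 0.
    apply/eqP => l0; have := lE _ (Fi t); rewrite l0 mul0r.
    have Q0 : 2 * coform (F t) (F t) = 0 -> coform (F t) (F t) = 0 by lia.
    by move/Q0/coform_eq0/(_ t tD); rewrite pairing_restr_coroot.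
  apply: (eq_coinv_proj rD aP) => y yI; apply: (mulfI l0).
  by rewrite -lE // lm -mE // E.
- move=> z /sR/restr_rootP[t tD ->]; rewrite [LHS]restr_pairing_proj.
  exact: pairing_restr_coroot.
- exact: reflR.
- move=> z w zR wR; exists (w - z *~ pairing w (coroot z)); first exact: reflR.
  have [[t tD zE] [b bD wE]] := (restr_rootP _ (sR z zR), restr_rootP _ (sR w wR)).
  have [c cD cE] := restr_rootP _ (sR _ (reflR z w zR wR)).
  rewrite [RHS](_ : _ = restr_coroot (pr c)); last by rewrite -cE.
  rewrite zE wE in cE *; apply: val_inj.
  rewrite [RHS](@restr_reflection_coroot t b c) //.
    rewrite raddfB raddfMz /=; congr (_ - _ *~ _).
    exact: restr_pairing_proj.
  by rewrite -cE [pairing _ _]restr_pairing_proj.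
Qed.

Lemma restr_root_datum : is_root_datum (restr a).
Proof.
apply: (@subdatum_restr_root_datum (roots (restr a))) => // z w.
move=> /restr_rootP[t tD ->] /restr_rootP[b bD ->].
have [c cD cE] := restr_reflection tD bD; apply/restr_rootP; exists c => //.
by rewrite cE [X in _ - _ *~ X]restr_pairing_proj.
Qed.

End RestrictedRoots.

(** * Reduced roots *)

(** An additive map carrying roots to roots preserves both divisibility and multipliability,
    whichever of the two the characteristic excludes. *)
Lemma reduced_roots_preimage (k : fieldType) (E E' : quadruple)
    (f : charlat E -> charlat E') z :
  {morph f : x y / x + y} -> {in roots E, forall w, f w \in roots E'} ->
  z \in roots E -> f z \in reduced_roots k E' -> z \in reduced_roots k E.
Proof.
move=> fD froots zE; rewrite /reduced_roots; case: ifP => _; rewrite !inE /= zE.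
  move=> /andP[_ /negP fz]; apply/negP => /froots; rewrite mulr2n fD.
  by rewrite -mulr2n => /fz.
move=> /andP[_ /allP fz]; apply/allP => w /froots wE.
by apply: contra (fz _ wE) => /eqP <-; rewrite !mulr2n fD.
Qed.

Lemma reduced_roots_sub (k : fieldType) (E : quadruple) :
  {subset reduced_roots k E <= roots E}.
Proof.
by move=> z; rewrite /reduced_roots; case: ifP => _; rewrite !inE => /andP[].
Qed.

Lemma reduced_roots_reflection (k : fieldType) (E : quadruple) : is_root_datum E ->
  {in reduced_roots k E &, forall z w,
    w - z *~ pairing w (coroot z) \in reduced_roots k E}.
Proof.
move=> rE z w zR wR; have [zE wE] := (reduced_roots_sub zR, reduced_roots_sub wR).
(* The reflection in [z] is an involution, so it carries the reflected root back to [w], which is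
   reduced. *)
apply: (reduced_roots_preimage (E' := E) (f := fun u => u - z *~ pairing u (coroot z))).
- by move=> u v; rewrite pairingDl mulrzDr opprD addrACA.
- by move=> u uE; apply: reflection_root.
- exact: reflection_root.
- rewrite pairingBl pairingMzl pairing_coroot //.
  have -> : pairing w (coroot z) - pairing w (coroot z) * 2 = - pairing w (coroot z).
    ring.
  by rewrite mulrNz opprK subrK.
Qed.

(** * Positive systems and regular invariant cocharacters *)

Section RegularInvariant.
Variables (D : quadruple) (rD : is_root_datum D) (G : finGroupType).
Variables (a : G -> charlat D -> charlat D) (aP : is_action a).

(** Average a cocharacter defining the preserved system: all translates of a positive root are
    positive, so nothing cancels. Negative roots follow by sign. *)
Lemma regular_invariant : preserves_positive_system a ->
  exists2 rho, rho \in inv_pred a & {in roots D, forall b, pairing b rho != 0}.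
Proof.
case=> P [y [yreg ->]] aPos; have [rho rhoI rhoE] := inv_average rD aP y.
have pos b : b \in roots D -> 0 < pairing b y -> 0 < pairing b rho.
  move=> bD b0; have ab g : 0 < pairing (a g b) y.
    by have := aPos g b; rewrite !inE /= bD b0 => /(_ isT)/andP[].
  by rewrite rhoE (bigD1 1%g) //= ltr_pwDl // sumr_ge0 // => g _; apply: ltW.
exists rho => // b bD; have := yreg b bD.
rewrite neq_lt => /orP[b0|b0]; last by rewrite gt_eqF // pos.
by have := pos _ (root_opp rD bD); rewrite !pairingNl !oppr_gt0 => /(_ b0)/lt_eqF ->.
Qed.

Lemma regular_invariant_positive rho :
  rho \in inv_pred a -> {in roots D, forall b, pairing b rho != 0} ->
  preserves_positive_system a.
Proof.
move=> rhoI rho_reg; exists [fset b in roots D | 0 < pairing b rho]%fset.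
  by exists rho.
by move=> g b; rewrite !inE /= pairing_inv // => /andP[/(act_root aP g) -> ->].
Qed.

End RegularInvariant.

(** * Automorphisms induced on a restricted root datum *)

Section InducedMaps.
Variables (D : quadruple) (rD : is_root_datum D) (G : finGroupType).
Variables (a : G -> charlat D -> charlat D) (aP : is_action a).
Implicit Types (x t : charlat D) (y : cocharlat D).

Local Notation pr := (coinv_proj a).
Local Notation F t := (val (restr_coroot (pr t))).

(** Weaker than equivariance, so as to cover both the Galois action, which commutes with [a], and a
    group acting on the coinvariants of a normal subgroup. *)
Definition normalizes (f : charlat D -> charlat D) :=
  forall g, exists g', forall x, f (a g x) = a g' (f x).

Lemma transpose_inv f f' : transpose f f' -> normalizes f ->
  {homo f' : y / y \in inv_pred a}.
Proof.
move=> ff' nf y yI; apply/asboolP => g x; rewrite -!ff'.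
by have [g' ->] := nf g; rewrite pairing_inv.
Qed.

Lemma restr_map_proj f x : is_morphism f -> normalizes f ->
  restr_map a a f (pr x) = pr (f x).
Proof.
case=> _ _ [f' ff' _] nf; apply: (eq_coinv_proj rD aP) => y yI.
by rewrite !ff' pairing_repr_proj //; apply: transpose_inv ff' nf y yI.
Qed.

Variables (rho : cocharlat D) (rhoI : rho \in inv_pred a).
Hypothesis rho_reg : {in roots D, forall b, pairing b rho != 0}.
Variable (R : {fset charlat (restr a)}).
Hypothesis sR : {subset R <= roots (restr a)}.

Lemma restr_map_morphism f f1 : is_morphism f -> is_morphism f1 -> cancel f1 f ->
  cancel f f1 -> normalizes f -> normalizes f1 ->
  {in R, forall z, restr_map a a f z \in R} ->
  @is_morphism (subdatum R) (subdatum R) (restr_map a a f).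
Proof.
move=> fM f1M f1K fK nf nf1 fR.
have [fD froots [f' ff' f'coroot]] := fM; have [_ f1roots _] := f1M.
have f'I y : y \in inv_pred a -> f' y \in inv_pred a by apply: transpose_inv ff' nf y.
have valf' (y : invariants a) :
    val (insubd (0 : invariants a) (f' (val y))) = f' (val y).
  by rewrite insubdK // f'I ?val_invariant.
split=> //.
  move=> z w; rewrite -[z]coinv_projK -[w]coinv_projK -raddfD /=.
  by rewrite !restr_map_proj // fD raddfD.
exists (fun y : invariants a => insubd (0 : invariants a) (f' (val y))).
  move=> z y; rewrite /= -[z]coinv_projK restr_map_proj //.
  by rewrite !restr_pairing_proj valf' ff'.
move=> z /sR/restr_rootP[t tD ->]; apply: val_inj; rewrite valf' restr_map_proj //=.
(* The transpose in [is_morphism] is a bare map; nondegeneracy of the pairing makes it additive. *)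
have f'D : {morph f' : y y' / y + y'}.
  move=> y y'; apply/eqP; rewrite -subr_eq0; apply/eqP; apply: (pairing_ndr rD) => x.
  by rewrite raddfB raddfD /= -!ff' raddfD subrr.
have ftD := froots t tD; apply/esym/(restr_coroot_uniq rD aP rhoI rho_reg tD).
- by rewrite f'I // val_invariant.
- have f'B : zmod_morphism f'.
    by move=> y y'; apply: (addIr (f' y')); rewrite -f'D !subrK.
  pose f'A : {additive cocharlat D -> cocharlat D} :=
    HB.pack f' (GRing.isZmodMorphism.Build _ _ _ f'B).
  (* A root [u] in the fibre of [f t] is [f (f1 u)], so [f'] sends its coroot to that of [f1 u],
     which lies over the class of [t]. *)
  have dirS : coroot_dir a t (f' (fibre_sum (pr (f t)))).
    rewrite -[f' _]/(f'A _) raddf_sum big_seq_cond; apply: coroot_dir_sum => //.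
    move=> u /andP[uD /eqP ut]; rewrite /= -(f1K u) f'coroot ?f1roots //.
    apply: coroot_dir_coroot; rewrite ?f1roots //.
    by rewrite -restr_map_proj // ut restr_map_proj // fK.
  rewrite (restr_corootE _ aP); case: ifP => // _.
  by rewrite -[f' _]/(f'A _) raddfMn pmulrn; apply: coroot_dirMz.
- by rewrite -ff' (pairing_restr_coroot rD aP rhoI rho_reg).
Qed.

End InducedMaps.

(** * Group actions induced on a restricted root datum *)

Section InducedAction.
Variables (D : quadruple) (rD : is_root_datum D) (G : finGroupType).
Variables (a : G -> charlat D -> charlat D) (aP : is_action a).
Variables (H : groupType) (b : H -> charlat D -> charlat D) (bP : is_action b).
Hypothesis nb : forall h, normalizes a (b h).

Local Notation pr := (coinv_proj a).

Lemma action_morphism h : is_morphism (b h).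
Proof. by have [/(_ h)[]] := bP. Qed.

Lemma restr_map_act h x : restr_map a a (b h) (pr x) = pr (b h x).
Proof. exact: (restr_map_proj rD aP x (action_morphism h) (nb h)). Qed.

Lemma restr_map_actD h : {morph restr_map a a (b h) : z w / z + w}.
Proof.
move=> z w; rewrite -(coinv_projK z) -(coinv_projK w) -raddfD !restr_map_act.
by have [bD _ _] := action_morphism h; rewrite bD raddfD.
Qed.

Lemma restr_map_act_root h :
  {in roots (restr a), forall z, restr_map a a (b h) z \in roots (restr a)}.
Proof.
move=> _ /restr_rootP[t tD ->]; rewrite restr_map_act; apply/restr_rootP.
by have [_ broots _] := action_morphism h; exists (b h t) => //; apply: broots.
Qed.

Lemma restr_map_actM h h' z : restr_map a a (b (h * h')%g) z
  = restr_map a a (b h) (restr_map a a (b h') z).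
Proof.
by have [_ _ bM] := bP; rewrite -[z]coinv_projK !restr_map_act bM.
Qed.

Lemma restr_map_act1 z : restr_map a a (b 1%g) z = z.
Proof. by have [_ b1 _] := bP; rewrite -[z]coinv_projK restr_map_act b1. Qed.

Lemma restr_map_act_reduced (k : fieldType) h :
  {in reduced_roots k (restr a), forall z,
    restr_map a a (b h) z \in reduced_roots k (restr a)}.
Proof.
move=> z zR; have zE := reduced_roots_sub zR.
(* The inverse group element carries the image back to the reduced root [z]. *)
apply: (@reduced_roots_preimage k (restr a) (restr a) (restr_map a a (b h^-1%g))).
- exact: restr_map_actD.
- exact: restr_map_act_root.
- exact: restr_map_act_root.
- by rewrite -restr_map_actM mulVg restr_map_act1.
Qed.

Variables (rho : cocharlat D) (rhoI : rho \in inv_pred a).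
Hypothesis rho_reg : {in roots D, forall b, pairing b rho != 0}.
Variable (R : {fset charlat (restr a)}).
Hypothesis sR : {subset R <= roots (restr a)}.
Hypothesis bR : forall h, {in R, forall z, restr_map a a (b h) z \in R}.

Lemma restr_map_is_action :
  @is_action H (subdatum R) (fun h => restr_map a a (b h)).
Proof.
have [_ b1 bM] := bP.
have morph h : @is_morphism (subdatum R) (subdatum R) (restr_map a a (b h)).
  apply: (restr_map_morphism rD aP rhoI rho_reg sR (f1 := b h^-1%g)) => //;
    try exact: action_morphism.
  - by move=> x; rewrite -[LHS]bM mulgV b1.
  - by move=> x; rewrite -[LHS]bM mulVg b1.
split=> [h||]; [|exact: restr_map_act1|exact: restr_map_actM].
split=> //; exists (restr_map a a (b h^-1%g)).
by split=> // z; rewrite -restr_map_actM ?mulVg ?mulgV restr_map_act1.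
Qed.

End InducedAction.

(** * Transitivity of restriction along an extension of groups *)

Section IteratedRestriction.
Variables (D : quadruple) (rD : is_root_datum D) (G0 G G1 : finGroupType).
Variables (i : {morphism [set: G0] >-> G}) (p : {morphism [set: G] >-> G1}).
Hypothesis ip : short_exact i p.
Variables (a : G -> charlat D -> charlat D) (aP : is_action a).
Variables (rho : cocharlat D) (rhoI : rho \in inv_pred a).
Hypothesis rho_reg : {in roots D, forall b, pairing b rho != 0}.
Implicit Types (x t : charlat D) (y : cocharlat D).

Definition sub_act (g0 : G0) := a (i g0).

Lemma sub_act_is_action : is_action sub_act.
Proof.
have [aut a1 aM] := aP; split=> [g|x|g h x]; rewrite /sub_act //.
  by rewrite morph1 a1.
by rewrite morphM ?in_setT // aM.
Qed.
Let a0P := sub_act_is_action.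

Lemma inv_sub y : y \in inv_pred a -> y \in inv_pred sub_act.
Proof. by move/asboolP => yI; apply/asboolP => g x; apply: yI. Qed.

Local Notation pr := (coinv_proj a).
Local Notation pr0 := (coinv_proj sub_act).
Local Notation lift := (lift_along p).

Lemma ker_act g x : p g = 1%g -> exists g0, a g x = sub_act g0 x.
Proof.
case: ip => _ kerE _ pg1; have : g \in ('ker p)%g by apply/kerP; rewrite ?in_setT.
by rewrite kerE => /morphimP[g0 _ _ ->]; exists g0.
Qed.

Lemma pr0_ker_act g x : p g = 1%g -> pr0 (a g x) = pr0 x.
Proof. by move/(ker_act x) => [g0 ->]; rewrite (coinv_proj_act rD a0P). Qed.

Lemma pr_repr_sub x : pr (coinv_repr (pr0 x)) = pr x.
Proof.
apply: (eq_coinv_proj rD aP) => y yI.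
exact: pairing_repr_proj (inv_sub yI).
Qed.

Lemma lift_alongK g1 : p (lift g1) = g1.
Proof.
rewrite /lift_along; case: pickP => [g /eqP //|no]; case: ip => _ _ im.
have : g1 \in (p @* [set: G])%g by rewrite im in_setT.
by case/morphimP => g _ _ gE; have := no g; rewrite gE eqxx.
Qed.

(** The image of [i] is the kernel of [p], hence normal. *)
Lemma normalizes_sub g : normalizes sub_act (a g).
Proof.
move=> g0; have [aut a1 aM] := aP.
have pi : p (i g0) = 1%g.
  case: ip => _ kerE _; apply/kerP; rewrite ?in_setT // kerE.
  by rewrite mem_morphim ?in_setT.
have : p (i g0 ^ g^-1)%g = 1%g by rewrite morphJ ?in_setT // pi conj1g.
case: ip => _ kerE _ /(kerP _ (in_setT _)); rewrite kerE => /morphimP[h _ _ hE].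
by exists h => x; rewrite /sub_act -hE -[LHS]aM -[RHS]aM conjgE invgK mulgA mulgKV.
Qed.

(** The natural map from the coinvariants of the subgroup to those of the group carries roots to
    roots, so [reduced_roots_preimage] applies to it. *)
Lemma reduced_roots_sub_act (k : fieldType) t : t \in roots D ->
  pr t \in reduced_roots k (restr a) -> pr0 t \in reduced_roots k (restr sub_act).
Proof.
move=> tD tred; pose f (z : coinv sub_act) := pr (coinv_repr z).
apply: (@reduced_roots_preimage k (restr sub_act) (restr a) f).
- move=> z w; rewrite /f -(coinv_projK z) -(coinv_projK w) -raddfD.
  by rewrite !pr_repr_sub raddfD.
- move=> _ /restr_rootP[u uD ->]; rewrite /f pr_repr_sub.
  by apply/restr_rootP; exists u.
- by apply/restr_rootP; exists t.
- by rewrite /f pr_repr_sub.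
Qed.

Variable (R : {fset charlat (restr sub_act)}).
Hypothesis sR : {subset R <= roots (restr sub_act)}.
Hypothesis reflR : {in R &, forall z w, w - z *~ pairing w (coroot z) \in R}.
Hypothesis aR : forall g, {in R, forall z, restr_map sub_act sub_act (a g) z \in R}.

Local Notation E := (subdatum R).

(** The body is that of [quotient_act], so that the equivariance required in [is_composition] holds
    by conversion. *)
Definition quot_act (g1 : G1) : charlat E -> charlat E :=
  restr_map sub_act sub_act (a (lift g1)).

Local Notation pr1 := (coinv_proj quot_act).

Let rE : is_root_datum E :=
  subdatum_restr_root_datum rD a0P (inv_sub rhoI) rho_reg sR reflR.

Lemma restr_map_sub g x : restr_map sub_act sub_act (a g) (pr0 x) = pr0 (a g x).
Proof. exact: (restr_map_act rD a0P aP normalizes_sub). Qed.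

(** Two lifts of [p g] differ by an element of the kernel, which acts trivially on the coinvariants
    of the subgroup. *)
Lemma quot_actE g x : quot_act (p g) (pr0 x) = pr0 (a g x).
Proof.
have [_ _ aM] := aP; rewrite /quot_act restr_map_sub.
have -> : lift (p g) = (lift (p g) * g^-1 * g)%g by rewrite mulgKV.
rewrite aM; apply: pr0_ker_act.
by rewrite morphM ?morphV ?in_setT // lift_alongK mulgV.
Qed.

Lemma quot_act_is_action : is_action quot_act.
Proof.
have [_ a1 aM] := aP.
have [aut _ _] :=
  restr_map_is_action rD a0P aP normalizes_sub (inv_sub rhoI) rho_reg sR aR.
split=> [g1|z|g1 h1 z]; first exact: aut.
  by rewrite -(coinv_projK z) -(morph1 p) quot_actE a1.
rewrite -(coinv_projK z) -(lift_alongK g1) -(lift_alongK h1) -morphM ?in_setT //=.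
by rewrite !quot_actE aM.
Qed.
Let a1P := quot_act_is_action.

(** Transitivity on the side of invariants; duality turns it into the identification of the
    coinvariants. *)
Lemma val_inv_quot (y : invariants sub_act) :
  (y \in @inv_pred E _ quot_act) = (val y \in inv_pred a).
Proof.
apply/asboolP/asboolP => yI g x.
  have := yI (p g) (pr0 x); rewrite quot_actE.
  by rewrite /pairing /= !restr_pairing_proj.
rewrite -(coinv_projK x) -(lift_alongK g) quot_actE.
by rewrite /pairing /= !restr_pairing_proj.
Qed.

Lemma quot_inv_exists y : y \in inv_pred a ->
  exists y1 : invariants quot_act, val (val y1) = y.
Proof.
move=> yI; have yI1 : Invariant (inv_sub yI) \in @inv_pred E _ quot_act.
  by rewrite val_inv_quot.
by exists (Invariant yI1).
Qed.

Lemma val_val_inv (y : invariants quot_act) : val (val y) \in inv_pred a.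
Proof. by rewrite -val_inv_quot; apply: val_invariant. Qed.

Lemma restr_restr_pairing x (y : invariants quot_act) :
  restr_pairing (pr1 (pr0 x)) y = pairing x (val (val y)).
Proof. by rewrite restr_pairing_proj [LHS]restr_pairing_proj. Qed.

Definition to_iterated (z : coinv a) : coinv quot_act := pr1 (pr0 (coinv_repr z)).
Definition of_iterated (w : coinv quot_act) : coinv a :=
  pr (coinv_repr (coinv_repr w : charlat (restr sub_act))).

Lemma to_iteratedE x : to_iterated (pr x) = pr1 (pr0 x).
Proof.
apply: (eq_coinv_proj rE a1P) => y yI.
rewrite [LHS]restr_pairing_proj [RHS]restr_pairing_proj.
by apply: pairing_repr_proj; rewrite -val_inv_quot.
Qed.

Lemma of_iteratedE x : of_iterated (pr1 (pr0 x)) = pr x.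
Proof.
apply: (eq_coinv_proj rD aP) => y /quot_inv_exists[y1 <-].
exact: restr_restr_pairing.
Qed.

Lemma iterated_ind (P : coinv quot_act -> Prop) :
  (forall x, P (pr1 (pr0 x))) -> forall w, P w.
Proof.
by move=> H w; rewrite -(coinv_projK w) -(coinv_projK (coinv_repr w)).
Qed.

Lemma to_iteratedK : cancel to_iterated of_iterated.
Proof. by move=> z; rewrite -(coinv_projK z) to_iteratedE of_iteratedE. Qed.

Lemma of_iteratedK : cancel of_iterated to_iterated.
Proof. by elim/iterated_ind => x; rewrite of_iteratedE to_iteratedE. Qed.

Lemma to_iteratedD : {morph to_iterated : x y / x + y}.
Proof.
move=> z w; rewrite -(coinv_projK z) -(coinv_projK w) -raddfD !to_iteratedE.
by rewrite raddfD [LHS]raddfD.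
Qed.

Lemma of_iteratedD : {morph of_iterated : x y / x + y}.
Proof.
elim/iterated_ind => x; elim/iterated_ind => y.
have -> : pr1 (pr0 x) + pr1 (pr0 y) = pr1 (pr0 (x + y)).
  by rewrite raddfD [RHS]raddfD.
by rewrite !of_iteratedE raddfD.
Qed.

(** [rho] is also regular for the intermediate datum, so the results on restricted roots apply to
    the second restriction. *)
Let rho1 : invariants sub_act := Invariant (inv_sub rhoI).
Let rho1I : rho1 \in @inv_pred E _ quot_act.
Proof. by rewrite val_inv_quot. Qed.
Let rho1_reg : {in roots E, forall z, @pairing E z rho1 != 0}.
Proof.
move=> z /sR/restr_rootP[t tD ->]; rewrite [pairing _ _]restr_pairing_proj.
exact: rho_reg.
Qed.

Lemma quot_positive : preserves_positive_system quot_act.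
Proof. exact: (regular_invariant_positive a1P rho1I rho1_reg). Qed.

(** By the uniqueness principle: the iterated coroot is the sum, possibly doubled, of coroots
    restricted along the subgroup, and each of these has the direction of [t] for the smaller set of
    invariants. *)
Lemma iterated_coroot t : t \in roots D -> pr0 t \in R ->
  val (val (restr_coroot (pr1 (pr0 t)))) = val (restr_coroot (pr t)).
Proof.
move=> tD tR; have a0rho := inv_sub rhoI.
apply/esym/(restr_coroot_uniq rD aP rhoI rho_reg tD).
- exact: val_val_inv.
- have dirS : coroot_dir a t (val (fibre_sum (pr1 (pr0 t)))).
    rewrite /fibre_sum raddf_sum big_seq_cond; apply: coroot_dir_sum => //.
    move=> z /andP[/sR/restr_rootP[u uD ->] /eqP ut].
    have [sp [l lE]] := restr_coroot_dir rD a0P u.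
    split=> //; exists l => y yI; rewrite lE ?inv_sub //; congr (_ * _).
    apply: (coinv_proj_pairing yI); rewrite -(of_iteratedE u) -(of_iteratedE t).
    by congr of_iterated.
  rewrite (restr_corootE _ a1P); case: ifP => _ //.
  by rewrite raddfMn pmulrn; apply: coroot_dirMz.
- have := pairing_restr_coroot rE a1P rho1I rho1_reg tR.
  by move=> <-; rewrite [RHS]restr_pairing_proj.
Qed.

Lemma of_iterated_root : {in roots (@restr E _ quot_act), forall w,
  of_iterated w \in roots (restr a)}.
Proof.
move=> _ /imfsetP[z /sR/restr_rootP[t tD ->] ->]; rewrite of_iteratedE.
by apply/restr_rootP; exists t.
Qed.

Lemma to_iterated_root x : pr0 x \in R ->
  to_iterated (pr x) \in roots (@restr E _ quot_act).
Proof. by move=> xR; rewrite to_iteratedE; apply/imfsetP; exists (pr0 x). Qed.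

Lemma to_iterated_morphism (D' : quadruple) (q : charlat D' -> coinv a) :
  @is_morphism D' (restr a) q ->
  {in roots D', forall b, exists t, [/\ t \in roots D, q b = pr t & pr0 t \in R]} ->
  @is_morphism D' (@restr E _ quot_act) (to_iterated \o q).
Proof.
case=> qD qroot [q' qq' q'coroot] lifts; split.
- by move=> x y /=; rewrite qD to_iteratedD.
- by move=> b /lifts[t [tD qt tR]] /=; rewrite qt to_iterated_root.
(* On cocharacters the identification is the inclusion of the iterated invariants, so the transpose
   is that of [q] precomposed with it. *)
pose h (y : invariants quot_act) : invariants a := Invariant (val_val_inv y).
exists (q' \o h) => [x y|b bD] /=.
  rewrite -qq' -(coinv_projK (q x)) to_iteratedE.
  by rewrite [LHS]restr_restr_pairing [RHS]restr_pairing_proj.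
have [t [tD qt tR]] := lifts b bD; rewrite -(q'coroot b bD); congr q'.
by apply: val_inj; rewrite qt to_iteratedE /= iterated_coroot.
Qed.

End IteratedRestriction.

(** * The intermediate root datum and the two parascopic data *)

Section Decomposition.
Variables (k K : fieldType) (iota : {rmorphism k -> K}).
Variables (Psi0 Psi2 : galois_root_datum iota) (G0 G G1 : finGroupType).
Variables (i : {morphism [set: G0] >-> G}) (p : {morphism [set: G] >-> G1}).
Hypothesis ip : short_exact i p.
Variable P : parascopic_datum Psi0 G Psi2.

Local Notation a := (ps_act P).
Local Notation aP := (ps_actP P).
Local Notation rD := (grd_root_datum Psi0).
Local Notation a0 := (sub_act i a).
Local Notation pr := (coinv_proj a).
Local Notation pr0 := (coinv_proj a0).
Local Notation a1 R := (@quot_act Psi0 G0 G G1 i p a R).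

Let a0P : is_action a0 := sub_act_is_action i aP.

Lemma normalizes_galois t : normalizes a0 (grd_act t).
Proof. by move=> g; exists g => x; rewrite /sub_act ps_commute. Qed.

(* [R] is the set of roots of the intermediate root datum. *)
Variable R : {fset charlat (restr a0)}.
Hypothesis sR : {subset R <= roots (restr a0)}.
Hypothesis reflR : {in R &, forall z w, w - z *~ pairing w (coroot z) \in R}.
Hypothesis aR : forall g, {in R, forall z, restr_map a0 a0 (a g) z \in R}.
Hypothesis galR : forall t, {in R, forall z, restr_map a0 a0 (grd_act t) z \in R}.
Hypothesis lifts : {in roots Psi2, forall b, exists t,
  [/\ t \in roots Psi0, ps_map P b = pr t & pr0 t \in R]}.

Lemma intermediate_datum : exists (Psi1 : galois_root_datum iota)
    (P0 : parascopic_datum Psi0 G0 Psi1) (P1 : parascopic_datum Psi1 G1 Psi2),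
  [/\ is_composition i p P P0 P1, torus_inclusive P0,
      torus_inclusive P -> torus_inclusive P1,
      {subset R <= reduced_roots k (restr a0)} -> root_inclusive P0 &
      root_inclusive P -> root_inclusive P1].
Proof.
have [rho rhoI rho_reg] := regular_invariant rD aP (ps_positive P).
have rho0I : rho \in inv_pred a0 := inv_sub i rhoI.
have rE : is_root_datum (subdatum R) :=
  subdatum_restr_root_datum rD a0P rho0I rho_reg sR reflR.
have galM t : is_morphism (grd_act t) := action_morphism (grd_actP Psi0) t.
have galE t x : restr_map a0 a0 (grd_act t) (pr0 x) = pr0 (grd_act t x).
  exact: (restr_map_proj rD a0P _ (galM t) (normalizes_galois t)).
have galP := restr_map_is_action rD a0P (grd_actP Psi0) normalizes_galois
  rho0I rho_reg sR galR.
(* A Galois element fixing a representative fixes its class. *)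
have galC (z : charlat (restr a0)) : exists s : seq K, forall t : gal iota,
    {in s, forall c, t c = c} -> restr_map a0 a0 (grd_act t) z = z.
  have [s sP] := grd_act_continuous (coinv_repr z).
  by exists s => t /sP tz; rewrite /restr_map tz coinv_projK.
pose Psi1 := @GaloisRootDatum _ _ iota (subdatum R) rE _ galP galC.
have id_morphism : @is_morphism (subdatum R) (restr a0) id.
  by split=> //; exists id.
have commute0 g (t : gal iota) x : a0 g (grd_act t x) = grd_act t (a0 g x).
  by rewrite /sub_act ps_commute.
pose P0 : parascopic_datum Psi0 G0 Psi1 :=
  @ParascopicDatum _ _ _ Psi0 G0 Psi1 a0 id a0P commute0
    (regular_invariant_positive a0P rho0I rho_reg) id_morphism (fun _ _ => erefl).
have actE g x : a1 R (p g) (pr0 x) = pr0 (a g x).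
  exact: (quot_actE rD ip aP).
pose a1P := quot_act_is_action rD ip aP rhoI rho_reg sR aR.
pose J := @to_iterated Psi0 G0 G G1 i p a R.
have commute1 g1 (t : gal iota) (z : charlat Psi1) :
    a1 R g1 (grd_act t z) = grd_act (g := Psi1) t (a1 R g1 z).
  rewrite -(lift_alongK ip g1) -(coinv_projK z) /= actE.
  by rewrite [LHS](congr1 _ (galE _ _)) actE galE ps_commute.
have q_morphism := to_iterated_morphism rD ip aP rhoI rho_reg sR reflR aR
  (ps_morphism P) lifts.
have equivariant1 t x : (J \o ps_map P) (grd_act t x)
  = restr_map (a1 R) (a1 R) (grd_act (g := Psi1) t) ((J \o ps_map P) x).
  rewrite /= ps_equivariant -(coinv_projK (ps_map P x)); set u := coinv_repr _.
  have na : normalizes a (grd_act t) by move=> g; exists g => z; rewrite ps_commute.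
  rewrite (restr_map_proj rD aP _ (galM t) na) /J.
  rewrite !(to_iteratedE rD ip aP rhoI rho_reg sR reflR aR) -galE.
  have n1 : normalizes (a1 R) (grd_act (g := Psi1) t).
    by move=> g; exists g => z; rewrite commute1.
  by rewrite (restr_map_proj rE a1P _ (action_morphism galP t) n1).
pose P1 : parascopic_datum Psi1 G1 Psi2 :=
  @ParascopicDatum _ _ _ Psi1 G1 Psi2 (a1 R) (J \o ps_map P) a1P commute1
    (quot_positive rD ip aP rhoI rho_reg sR aR) q_morphism equivariant1.
have ofK := of_iteratedK rD ip aP rhoI rho_reg sR reflR aR.
have toK := to_iteratedK rD ip aP rhoI rho_reg sR reflR aR.
exists Psi1, P0, P1; split.
- split=> // x; rewrite -[LHS]toK; set w := to_iterated _ _ _.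
  (* The coinvariants of [subdatum R] and of [restr a0] are not convertible unless
     [R] is the set of all roots. *)
  have := of_iteratedE rD ip aP (roots (restr a0)) (coinv_repr (coinv_repr w : coinv a0)).
  by rewrite coinv_projK => /esym.
- by split=> //; exists id.
- case=> _ q_bij; split; first exact: q_morphism.
  by apply: bij_comp q_bij; exists (@of_iterated Psi0 G0 G G1 i p a R).
- by move=> Rred; split=> //; exists id.
(* [of_iterated] is additive, carries roots to roots and undoes [to_iterated]; a root whose image is
   reduced is reduced. *)
- case=> _ q_red _; have [qD qroots qcoroot] := q_morphism; split=> // b bD.
  apply: (@reduced_roots_preimage k (@restr (subdatum R) G1 (a1 R)) (restr a)
            (@of_iterated Psi0 G0 G G1 i p a R)).
  + exact: (of_iteratedD rD ip aP).
  + exact: (of_iterated_root rD ip aP sR).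
  + exact: qroots.
  + by rewrite /= toK q_red.
Qed.

End Decomposition.

Theorem proposition6p1 (k ksep : fieldType) (iota : {rmorphism k -> ksep})
    (ksep_closure : separable_closure iota)
    (Psi0 Psi2 : galois_root_datum iota)
    (Gamma0 Gamma Gamma1 : finGroupType)
    (P : parascopic_datum Psi0 Gamma Psi2)
    (i : {morphism [set: Gamma0] >-> Gamma})
    (p : {morphism [set: Gamma] >-> Gamma1})
    (exact : short_exact i p) :
  [/\ exists (Psi1 : galois_root_datum iota)
             (P0 : parascopic_datum Psi0 Gamma0 Psi1)
             (P1 : parascopic_datum Psi1 Gamma1 Psi2),
        is_composition i p P P0 P1 /\ torus_inclusive P0,
      torus_inclusive P ->
      exists (Psi1 : galois_root_datum iota)
             (P0 : parascopic_datum Psi0 Gamma0 Psi1)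
             (P1 : parascopic_datum Psi1 Gamma1 Psi2),
        [/\ is_composition i p P P0 P1, torus_inclusive P0
          & torus_inclusive P1]
    & root_inclusive P ->
      exists (Psi1 : galois_root_datum iota)
             (P0 : parascopic_datum Psi0 Gamma0 Psi1)
             (P1 : parascopic_datum Psi1 Gamma1 Psi2),
        [/\ is_composition i p P P0 P1, torus_inclusive P0,
            root_inclusive P0 & root_inclusive P1]].
Proof.
have [rD aP] := (grd_root_datum Psi0, ps_actP P).
have a0P := sub_act_is_action i aP.
have [rho rhoI rho_reg] := regular_invariant rD aP (ps_positive P).
have r0 := restr_root_datum rD a0P (inv_sub i rhoI) rho_reg.
have galN := normalizes_galois i P.
have [_ proots _] := ps_morphism P.
(* With all restricted roots, one intermediate datum settles both the unconditional and the
   torus-inclusive claim. *)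
have [|||||Psi1 [P0 [P1 [compP torus0 torus1 _ _]]]] :=
  @intermediate_datum _ _ iota Psi0 Psi2 _ _ _ i p exact P
    (roots (restr (sub_act i (ps_act P)))).
- by [].
- exact: reflection_root.
- by move=> g; apply: (restr_map_act_root rD a0P aP (normalizes_sub exact aP)).
- by move=> t; apply: (restr_map_act_root rD a0P (grd_actP Psi0) galN).
- move=> b /proots/restr_rootP[t tD bt]; exists t; split=> //.
  by apply/restr_rootP; exists t.
split; first by exists Psi1, P0, P1.
  by move=> /torus1 torusP; exists Psi1, P0, P1.
move=> rootP; have [_ pred _] := rootP.
have [|||||Psi1' [P0' [P1' [compP' torus0' _ root0 root1]]]] :=
  @intermediate_datum _ _ iota Psi0 Psi2 _ _ _ i p exact P
    (reduced_roots k (restr (sub_act i (ps_act P)))).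
- exact: reduced_roots_sub.
- exact: reduced_roots_reflection.
- by move=> g; apply: (restr_map_act_reduced rD a0P aP (normalizes_sub exact aP)).
- by move=> t; apply: (restr_map_act_reduced rD a0P (grd_actP Psi0) galN).
(* Root-inclusiveness makes the class of [t] along the whole group reduced, hence also its class
   along the subgroup. *)
- move=> b bD; have /restr_rootP[t tD bt] := proots b bD.
  exists t; split=> //; apply: (reduced_roots_sub_act rD i aP tD).
  by rewrite -bt; apply: pred.
by exists Psi1', P0', P1'; split=> //; [apply: root0 | apply: root1].
Qed.
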